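(* Let $\mathcal{A}$ be the class of all two-sorted algebras $\langle C,A\rangle$ where $C$ is finitely generated as an $A$-module and the additive group $A^+$ is finitely generated as an abelian group. For each $\langle C,A\rangle\in\mathcal{A}$ there exists a sentence $\phi_{C,A}$ of $L_3$ such that $\langle C,A\rangle\models\phi_{C,A}$ and for any $\langle D,B\rangle\in\mathcal{A}$, $$\langle D,B\rangle\models\phi_{C,A}\iff\langle C,A\rangle\cong\langle D,B\rangle$$ as two-sorted algebras.
   Context: A scalar ring is a commutative associative ring with unit. For a scalar ring $A$, an $A$-algebra $C$ is an abelian group with an $A$-module structure equipped with an $A$-bilinear binary operation (multiplication); it is not assumed associative, commutative or unital. A two-sorted algebra $\langle C,A\rangle$ consists of a ring $C$ (in the signature $\langle+,\cdot,0\rangle$), a scalar ring $A$ (in the signature $\langle +,\cdot,0,1\rangle$) and a predicate describing the scalar multiplication $A\times C\to C$ which makes $C$ an $A$-algebra. $L_3$ is the first-order language of two-sorted algebras. An isomorphism of two-sorted algebras $\langle C,A\rangle\to\langle D,B\rangle$ is a pair consisting of a ring isomorphism $C\to D$ and a ring isomorphism $A\to B$ compatible with the scalar multiplications. *)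

(* Defs.v *)
From mathcomp Require Import all_boot all_order all_algebra.

Set Implicit Arguments.
Unset Strict Implicit.
Unset Printing Implicit Defensive.

Import GRing.Theory.

Local Open Scope ring_scope.

(* The multiplication of [carrier] is neither associative, commutative nor
   unital. [comPzRingType] does not require 1 != 0, so the zero ring is a
   scalar ring. *)
Record two_sorted_algebra := TwoSortedAlgebra {
  scalar : comPzRingType;
  carrier : lmodType scalar;
  amul : carrier -> carrier -> carrier;
  amul_linearl : forall y, linear (amul^~ y);
  amul_linearr : forall x, linear (amul x)
}.

(* Variables of each sort are named by natural numbers, independently for the
   two sorts. *)
Inductive cterm :=
| CVar of nat
| CZero
| CAdd of cterm & cterm
| CMul of cterm & cterm.

Inductive aterm :=
| AVar of nat
| AZero
| AOne
| AAdd of aterm & aterm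
| AMul of aterm & aterm.

(* [Scal a x y] is the atomic formula for the scalar multiplication predicate,
   meaning a x = y. *)
Inductive formula :=
| EqC of cterm & cterm
| EqA of aterm & aterm
| Scal of aterm & cterm & cterm
| Bot
| Not of formula
| And of formula & formula
| Or of formula & formula
| Imp of formula & formula
| AllC of nat & formula
| ExC of nat & formula
| AllA of nat & formula
| ExA of nat & formula.

Fixpoint cterm_vars (t : cterm) : seq nat :=
  match t with
  | CVar n => [:: n]
  | CZero => [::]
  | CAdd t1 t2 | CMul t1 t2 => cterm_vars t1 ++ cterm_vars t2
  end.

Fixpoint aterm_vars (t : aterm) : seq nat :=
  match t with
  | AVar n => [:: n]
  | AZero | AOne => [::]
  | AAdd t1 t2 | AMul t1 t2 => aterm_vars t1 ++ aterm_vars t2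
  end.

Fixpoint free_cvars (phi : formula) : seq nat :=
  match phi with
  | EqC t1 t2 | Scal _ t1 t2 => cterm_vars t1 ++ cterm_vars t2
  | EqA _ _ | Bot => [::]
  | Not p | AllA _ p | ExA _ p => free_cvars p
  | And p q | Or p q | Imp p q => free_cvars p ++ free_cvars q
  | AllC n p | ExC n p => [seq m <- free_cvars p | m != n]
  end.

Fixpoint free_avars (phi : formula) : seq nat :=
  match phi with
  | EqA t1 t2 => aterm_vars t1 ++ aterm_vars t2
  | Scal t _ _ => aterm_vars t
  | EqC _ _ | Bot => [::]
  | Not p | AllC _ p | ExC _ p => free_avars p
  | And p q | Or p q | Imp p q => free_avars p ++ free_avars q
  | AllA n p | ExA n p => [seq m <- free_avars p | m != n]
  end.

Definition is_sentence (phi : formula) : Prop :=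
  free_cvars phi = [::] /\ free_avars phi = [::].

Section Semantics.
Variable M : two_sorted_algebra.

Fixpoint ceval (e : nat -> carrier M) (t : cterm) : carrier M :=
  match t with
  | CVar n => e n
  | CZero => 0
  | CAdd t1 t2 => ceval e t1 + ceval e t2
  | CMul t1 t2 => amul (ceval e t1) (ceval e t2)
  end.

Fixpoint aeval (e : nat -> scalar M) (t : aterm) : scalar M :=
  match t with
  | AVar n => e n
  | AZero => 0
  | AOne => 1
  | AAdd t1 t2 => aeval e t1 + aeval e t2
  | AMul t1 t2 => aeval e t1 * aeval e t2
  end.

Fixpoint sat (ec : nat -> carrier M) (ea : nat -> scalar M) (phi : formula) :
    Prop :=
  match phi with
  | EqC t1 t2 => ceval ec t1 = ceval ec t2
  | EqA t1 t2 => aeval ea t1 = aeval ea t2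
  | Scal a t1 t2 => aeval ea a *: ceval ec t1 = ceval ec t2
  | Bot => False
  | Not p => ~ sat ec ea p
  | And p q => sat ec ea p /\ sat ec ea q
  | Or p q => sat ec ea p \/ sat ec ea q
  | Imp p q => sat ec ea p -> sat ec ea q
  | AllC n p => forall x, sat [eta ec with n |-> x] ea p
  | ExC n p => exists x, sat [eta ec with n |-> x] ea p
  | AllA n p => forall a, sat ec [eta ea with n |-> a] p
  | ExA n p => exists a, sat ec [eta ea with n |-> a] p
  end.

(* For a sentence the valuations are irrelevant. *)
Definition models (phi : formula) : Prop := forall ec ea, sat ec ea phi.

End Semantics.

Definition fin_gen_module (A : pzRingType) (V : lmodType A) : Prop :=
  exists (n : nat) (g : 'I_n -> V),
    forall x : V, exists c : 'I_n -> A, x = \sum_(i < n) c i *: g i.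

Definition fin_gen_abelian (V : zmodType) : Prop :=
  exists (n : nat) (g : 'I_n -> V),
    forall x : V, exists c : 'I_n -> int, x = \sum_(i < n) g i *~ c i.

Definition in_classA (M : two_sorted_algebra) : Prop :=
  fin_gen_module (carrier M) /\ fin_gen_abelian (scalar M).

Definition isomorphic (M N : two_sorted_algebra) : Prop :=
  exists (f : {additive carrier M -> carrier N})
         (g : {rmorphism scalar M -> scalar N}),
    [/\ bijective f, bijective g,
        forall x y, f (amul x y) = amul (f x) (f y)
      & forall a x, f (a *: x) = g a *: f x].

(* Main.v *)
From HB Require Import structures.
From mathcomp Require Import all_boot all_order all_algebra.
From mathcomp Require Import ssrAC separable boolp ring zify.
Require Import Defs.

(** Write M = <C, A>. Both A and C are finitely generated abelian groups, so M
    has a finite presentation: additive generators, finitely many additive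
    relations (subgroups of finitely generated abelian groups are finitely
    generated, [subgroup_fin_gen]) and multiplication tables. In any N = <E, B>
    where elements satisfy this presentation there is a homomorphism (f, h) from
    M to N ([presented_morphism]). The point is to force f and h to be bijective
    by finitely many first-order conditions, without having to define the
    integers, or additive generation, in N.

    Torsion. Let m kill the torsion of A. That m B is torsion free follows from
    two conditions with quantifiers over B alone: m B has no 2-torsion, and
    (1 + 2 y) t = 0 with t in m B and y in B implies t = 0
    ([torsion_of_test]). They hold in A because such a t satisfies t = - 2 y t,
    which makes Z[y] t divisible by 2, hence finite. So torsion is the kernel of
    m in both rings, and likewise the torsion of C and E is definable. Requiring
    in addition that m x ^ 2k = 0 implies m x ^ k = 0, for one large k, makes
    the elements nilpotent modulo torsion those with m x ^ k = 0.

    Injectivity. Injectivity modulo an integer D = m e with e > 1 is a condition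
    on finitely many elements, and it makes the kernel divisible by e, hence
    torsion, hence zero ([injective_mod_multiples]).

    Surjectivity of h. Let nilt be the ideal of elements nilpotent modulo
    torsion. One requires B = h(A) + D B + nilt B; then L = h(A) + nilt B has
    index prime to D in B ([span_nakayama]). The ring A / nilt A is reduced and
    torsion free, so it stays reduced modulo all primes outside a finite set
    ([almost_all_primes_reduced]), and D is chosen divisible by the exceptional
    primes. If p does not divide D, p x lies in L and x is in B, then the
    integrality of x makes the corresponding element of A nilpotent modulo p, so
    divisible by p up to nilpotents, so x lies in L. Hence B = L. Requiring moreover that nilt B is
    generated as an ideal by elements of h(A), and that the torsion of B lies in
    h(A), gives B = h(A), because that ideal is nilpotent modulo torsion
    ([rmorph_surj_mod_nil], [ring_test_surj]).

    Surjectivity of f. It follows from that of h once E is generated as a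
    B-module by the images of generators of C, which is a first-order condition.

    The sentence asserts the existence of elements satisfying the presentation
    and these conditions; they hold in M for the identity map, and isomorphisms
    preserve the truth of sentences. *)

Set Implicit Arguments.
Unset Strict Implicit.
Unset Printing Implicit Defensive.

Import Order.TTheory GRing.Theory Num.Theory.

Local Open Scope ring_scope.

(** * Subgroups of finitely generated abelian groups *)

Section AbelianGroups.
Variable V : zmodType.
Implicit Types (P Q : V -> Prop) (g : seq V) (x y v : V).

Definition subgroup P := P 0 /\ forall x y, P x -> P y -> P (x - y).

Lemma subgroup0 P : subgroup P -> P 0. Proof. by case. Qed.

Lemma subgroupB P x y : subgroup P -> P x -> P y -> P (x - y).
Proof. by case=> _; apply. Qed.

Lemma subgroupN P x : subgroup P -> P x -> P (- x).
Proof. by move=> sP Px; rewrite -sub0r; apply: subgroupB => //; case: sP. Qed.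

Lemma subgroupD P x y : subgroup P -> P x -> P y -> P (x + y).
Proof.
move=> sP Px Py; rewrite -[y]opprK; apply: subgroupB => //.
exact: subgroupN.
Qed.

Lemma subgroupMn P x n : subgroup P -> P x -> P (x *+ n).
Proof.
move=> sP Px; elim: n => [|n IHn]; first by rewrite mulr0n; case: sP.
by rewrite mulrS; apply: subgroupD.
Qed.

Lemma subgroupMz P x z : subgroup P -> P x -> P (x *~ z).
Proof.
move=> sP Px; case: z => n; first exact: subgroupMn.
by rewrite NegzE mulrNz; apply: subgroupN => //; apply: subgroupMn.
Qed.

Lemma subgroup_sum P (I : Type) (r : seq I) (p : pred I) (F : I -> V) :
  subgroup P -> (forall i, p i -> P (F i)) -> P (\sum_(i <- r | p i) F i).
Proof.
move=> sP PF; elim/big_ind: _ => //; first by case: sP.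
by move=> x y; apply: subgroupD.
Qed.

(** Integer combinations of a list, peeled off one generator at a time so that
    proofs can go by induction on the list. *)
Fixpoint span g x : Prop :=
  if g is v :: g' then exists z : int, span g' (x - v *~ z) else x = 0.

Lemma span_subgroup g : subgroup (span g).
Proof.
elim: g => [|v g [s0 sB]] /=.
  by split=> // x y -> ->; rewrite subr0.
split; first by exists 0; rewrite mulr0z subr0.
move=> x y [z sx] [w sy]; exists (z - w).
have -> : x - y - v *~ (z - w) = (x - v *~ z) - (y - v *~ w); last exact: sB.
by rewrite mulrzBr !opprB [LHS](AC (2*2) ((1*4)*(3*2)))%AC.
Qed.

Lemma span_tail v g x : span g x -> span (v :: g) x.
Proof. by move=> sx; exists 0; rewrite mulr0z subr0. Qed.

Lemma mem_span g x : x \in g -> span g x.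
Proof.
elim: g => // v g IHg; rewrite inE => /predU1P[->|/IHg]; last exact: span_tail.
by exists 1; rewrite mulr1z subrr; case: (span_subgroup g).
Qed.

Lemma span_min g P x :
  subgroup P -> (forall v, v \in g -> P v) -> span g x -> P x.
Proof.
move=> sP; elim: g x => [|v g IHg] x Pg /=; first by move=> ->; case: sP.
case=> z /IHg Px; rewrite -[x](subrK (v *~ z)); apply: subgroupD => //.
  by apply: Px => u gu; apply: Pg; rewrite inE gu orbT.
by apply: subgroupMz => //; apply: Pg; rewrite mem_head.
Qed.

Lemma span_coord g x :
  span g x -> exists c : 'rV[int]_(size g), x = \sum_(i < size g) g`_i *~ c 0 i.
Proof.
elim: g x => [|v g IHg] x /= => [->|[z /IHg[c def_x]]].
  by exists 0; rewrite big_ord0.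
exists (\row_(i < (size g).+1) oapp (c 0) z (unlift ord0 i)).
rewrite big_ord_recl mxE unlift_none /= addrC -[LHS](subrK (v *~ z)) def_x.
by congr (_ + _); apply: eq_bigr => i _; rewrite mxE liftK.
Qed.

End AbelianGroups.

Lemma subgroup_int (P : int -> Prop) : subgroup P ->
  exists2 d, P d & forall z, P z -> exists q, z = d * q.
Proof.
move=> sP; case: (EM (exists n : nat, `[< (0 < n)%N /\ P n%:Z >])) => [exP|noP].
  case: (ex_minnP exP) => n /asboolP[n0 Pn] minn; exists n%:Z => // z Pz.
  exists (z %/ n%:Z)%Z; have nZ0 : n%:Z != 0 by lia.
  have := divz_eq z n%:Z; rewrite mulrC; set r := (z %% n%:Z)%Z => def_z.
  have r_ge0 : (0 <= r)%R by rewrite modz_ge0.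
  have r_lt : (r < n%:Z)%R by rewrite ltz_pmod //; lia.
  have Pr : P r.
    have -> : r = z - n%:Z *~ (z %/ n%:Z)%Z by rewrite mulrzz {1}def_z; ring.
    by apply: subgroupB => //; apply: subgroupMz.
  case: (eqVneq r 0) => [r0|rN0]; first by rewrite {1}def_z r0 addr0.
  have := minn `|r|%N; rewrite asboolT; first by lia.
  by split; [lia | rewrite gez0_abs].
exists 0; first by case: sP.
move=> z Pz; exists 0; rewrite mul0r; apply/eqP; apply: contra_notT noP => zN0.
exists `|z|%N; apply/asboolP; split; first lia.
have [->|->] : `|z|%N = z :> int \/ `|z|%N = - z :> int by lia.
  by [].
exact: subgroupN.
Qed.

Section Noetherian.
Variable V : zmodType.
Implicit Types (P Q : V -> Prop) (g : seq V) (x y v : V).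

(** Subgroups of finitely generated abelian groups are finitely generated: the
    coefficients of the first generator v form an ideal d Z, and one element of
    P with coefficient d reduces P to its intersection with the span of the
    other generators. *)
Lemma subgroup_fin_gen g P : subgroup P -> (forall x, P x -> span g x) ->
  exists2 s : seq V, (forall v, v \in s -> P v) & forall x, P x -> span s x.
Proof.
elim: g P => [|v g IHg] P sP Pg.
  by exists [::] => // x /Pg ->.
pose I z := exists2 w, span g w & P (v *~ z + w).
have sI : subgroup I.
  split; first by exists 0; [case: (span_subgroup g)
                            | rewrite mulr0z addr0; case: sP].
  move=> z z' [w gw Pw] [w' gw' Pw']; exists (w - w').
    exact: subgroupB (span_subgroup g) gw gw'.
  by rewrite mulrzBr addrACA -opprD; apply: subgroupB.
have [d [w0 gw0 Pw0] genI] := subgroup_int sI.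
pose P0 x := P x /\ span g x.
have [|x [] //|s sP0 genP0] := IHg P0.
  split; first by split; [case: sP | case: (span_subgroup g)].
  move=> x y [Px gx] [Py gy]; split; first exact: subgroupB.
  exact: subgroupB (span_subgroup g) gx gy.
exists ((v *~ d + w0) :: s).
  by move=> u; rewrite inE => /predU1P[->//|/sP0[]].
move=> x Px; have [z gx] := Pg x Px.
have [|q def_z] := genI z.
  by exists (x - v *~ z); rewrite // addrC subrK.
exists q; apply: genP0; split; first by apply: subgroupB => //; apply: subgroupMz.
have -> : x - (v *~ d + w0) *~ q = (x - v *~ z) - w0 *~ q.
  by rewrite mulrzDl -mulrzA -def_z opprD addrA.
by apply: (subgroupB (span_subgroup g)) gx _; apply: subgroupMz => //;
  apply: span_subgroup.
Qed.

Definition torsion x := exists2 n, (0 < n)%N & x *+ n = 0.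

Lemma torsion_subgroup : subgroup torsion.
Proof.
split; first by exists 1%N.
move=> x y [n n0 xn] [m m0 ym]; exists (n * m)%N; first by rewrite muln_gt0 n0.
by rewrite mulrnBl mulrnA xn mul0rn mulnC mulrnA ym mul0rn subrr.
Qed.

Lemma torsion_mulrn x n : (0 < n)%N -> torsion (x *+ n) -> torsion x.
Proof.
move=> n0 [m m0]; rewrite -mulrnA => xnm; exists (n * m)%N => //.
by rewrite muln_gt0 n0.
Qed.

(** A Nakayama lemma: X = e X + Q gives n X <= Q with n prime to e. The usual
    determinant of 1 - e Z is traded for an elimination of one generator at a
    time. The conclusion says that X modulo Q has an exponent prime to e. *)
Lemma span_nakayama g Q (e : int) : subgroup Q ->
    (forall x, span g x -> exists2 y, span g y & Q (x - y *~ e)) ->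
  exists2 n, coprimez n e & forall x, span g x -> Q (x *~ n).
Proof.
elim: g Q => [|v g IHg] Q sQ expand.
  exists 1; first exact: coprime1n.
  by move=> x /= ->; rewrite mul0rz; case: sQ.
have [sg sg'] := (span_subgroup g, span_subgroup (v :: g)).
have [y [z gw] Qv] := expand v (mem_span (mem_head v g)).
have [w {}gw def_y] : exists2 w, span g w & y = w + v *~ z.
  by exists (y - v *~ z); rewrite ?subrK.
(* Solving the relation for v: n1 v lies in e <g> + Q. *)
pose n1 := 1 - z * e.
have {}Qv : Q (v *~ n1 - w *~ e).
  have -> // : v *~ n1 - w *~ e = v - y *~ e.
  rewrite def_y /n1 mulrzBr mulr1z mulrzDl opprD -mulrzA.
  by rewrite -addrA [- _ - _]addrC.
have co1 : coprimez n1 e.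
  by apply/coprimezP; exists (1, z); rewrite /n1 /=; ring.
have [|n con Qn] := IHg Q sQ.
  move=> u gu; have [y' [z' gw'] Qu] := expand u (span_tail v gu).
  have [w' {}gw' def_y'] : exists2 w', span g w' & y' = w' + v *~ z'.
    by exists (y' - v *~ z'); rewrite ?subrK.
  exists (w *~ (z' * e) + w' *~ n1 + u *~ z).
    by apply: subgroupD => //; [apply: subgroupD => //|]; apply: subgroupMz.
  have -> : u - (w *~ (z' * e) + w' *~ n1 + u *~ z) *~ e
     = (v *~ n1 - w *~ e) *~ (z' * e) + (u - y' *~ e) *~ n1.
    rewrite def_y'
      !(mulrzDl, mulNrz) -!mulrzA.
    have -> : z * e = 1 - n1 by rewrite /n1; ring.
    have -> : z' * e * e = e * (z' * e) by ring.
    have -> : n1 * (z' * e) = z' * (e * n1) by ring.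
    have -> : n1 * e = e * n1 by ring.
    rewrite mulrzBr mulr1z.
    set a := u *~ n1; set b := v *~ _; set c := w *~ _; set d := w' *~ _.
    rewrite !opprD opprK [LHS](AC (1*(2*2)) ((1*4)*((5*2)*3)))%AC.
    by rewrite [RHS](AC (2*(1*2)) ((1*5)*((3*2)*4)))%AC /= !subrr.
  by apply: subgroupD => //; apply: subgroupMz.
exists (n1 * n); first by rewrite coprimezMl co1.
move=> x [z' gx]; rewrite -[x](subrK (v *~ z')) mulrzDl.
apply: subgroupD => //.
  by rewrite mulrC mulrzA; apply: subgroupMz => //; apply: Qn.
have -> : v *~ z' *~ (n1 * n) = v *~ n1 *~ (z' * n).
  by rewrite -!mulrzA; congr (_ *~ _); ring.
rewrite -[v *~ n1](subrK (w *~ e)) mulrzDl.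
apply: subgroupD => //; first exact: subgroupMz.
rewrite (_ : _ *~ _ = w *~ (e * z') *~ n); last first.
  by rewrite -!mulrzA; congr (_ *~ _); ring.
by apply: Qn; apply: subgroupMz.
Qed.


(** The case Q = 0: an integer prime to e > 1 is not zero, so killing P by it
    makes P a torsion group. *)
Lemma divisible_torsion g P e : (forall x, span g x) -> subgroup P ->
  (1 < e)%N -> (forall x, P x -> exists2 y, P y & x = y *+ e) ->
  forall x, P x -> torsion x.
Proof.
move=> genV sP e1 divP.
have [s sP' genP] := subgroup_fin_gen sP (fun x _ => genV x).
have sub_sP x : span s x -> P x by apply: span_min.
have s0 : subgroup (fun x : V => x = 0).
  by split=> // x y -> ->; rewrite subr0.
have [|n con n0] := @span_nakayama s (fun x => x = 0) e s0.
  by move=> x /sub_sP/divP[y /genP sy ->]; exists y; rewrite // subrr.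
have nN0 : n != 0 by apply: contraTneq con => ->; rewrite /coprimez gcd0z; lia.
move=> x /genP/n0 xn; exists `|n|%N; first by lia.
have [nE|nE] : `|n|%N = n :> int \/ `|n|%N = - n :> int by lia.
  by rewrite pmulrn nE.
by rewrite pmulrn nE mulrNz xn oppr0.
Qed.

Lemma span_torsion g : (forall v, v \in g -> torsion v) ->
  exists2 m, (0 < m)%N & forall x, span g x -> x *+ m = 0.
Proof.
elim: g => [|v g IHg] tg; first by exists 1%N => // x ->.
have [|m m0 gm] := IHg; first by move=> u gu; apply: tg; rewrite inE gu orbT.
have [n n0 vn] := tg v (mem_head v g).
exists (m * n)%N; first by rewrite muln_gt0 m0.
move=> x [z /gm xm]; rewrite -[x](subrK (v *~ z)) mulrnDl mulrnA xm mul0rn add0r.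
have -> : v *~ z *+ (m * n) = v *+ n *~ (m%:Z * z).
  by rewrite !pmulrn -!mulrzA PoszM; congr (_ *~ _); ring.
by rewrite vn mul0rz.
Qed.

Lemma torsion_exponent g : (forall x, span g x) ->
  exists2 m, (0 < m)%N & forall x, torsion x -> x *+ m = 0.
Proof.
move=> genV; have [s ts gs] :=
  subgroup_fin_gen torsion_subgroup (fun x _ => genV x).
have [m m0 sm] := span_torsion ts.
by exists m => // x /gs/sm.
Qed.

(** The quotient modulo D is finite, as every coefficient can be reduced
    modulo D. *)
Lemma span_residues g D : (0 < D)%N ->
  exists r : seq V, (forall v, v \in r -> span g v) /\ forall x, span g x ->
    exists v y, [/\ v \in r, span g y & x = v + y *+ D].
Proof.
move=> D0; elim: g => [|v g [r [gr IHr]]].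
  exists [:: 0]; split=> [x|x /= ->]; first by rewrite inE => /eqP.
  by exists 0, 0; rewrite mul0rn addr0 mem_head.
exists [seq u + v *+ i | u <- r, i <- iota 0 D]; split.
  move=> _ /allpairsP[[u i] [/gr gu _ ->]] /=; exists i%:Z.
  by rewrite -pmulrn addrK.
move=> x [z /IHr[u [y [ru gy def_x]]]].
(* replace the coefficient z of v by its remainder k *)
have [k kD def_z] : exists2 k, (k < D)%N & z = k%:Z + (z %/ D%:Z)%Z * D%:Z.
  exists `|(z %% D%:Z)%Z|%N; first by rewrite -ltz_nat; lia.
  by rewrite {1}(divz_eq z D%:Z) addrC gez0_abs // modz_ge0 //; lia.
exists (u + v *+ k), (y + v *~ (z %/ D%:Z)%Z); split.
- by apply/allpairsP; exists (u, k); rewrite /= mem_iota.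
- by exists (z %/ D%:Z)%Z; rewrite addrK.
rewrite mulrnDl addrACA -def_x !pmulrn -mulrzA -mulrzDr -def_z.
by rewrite subrK.
Qed.

End Noetherian.

(** Finitely many elements S witness the nonzero classes modulo D: a map that
    sends no member of S to a multiple of D is injective modulo D. *)
Lemma nonzero_residues (V : zmodType) (g : seq V) D :
    (forall x, span g x) -> (0 < D)%N ->
  exists S : seq V, (forall v, v \in S -> forall y, y *+ D <> v) /\
    forall x, (exists y, x = y *+ D) \/
              exists v y, v \in S /\ x = v + y *+ D.
Proof.
move=> genV D0; have [R [_ resR]] := span_residues g D0.
exists [seq v <- R | ~~ `[< exists y, v = y *+ D >]]; split=> [v|x].
  rewrite mem_filter => /andP[/asboolPn vN0 _] y vy; apply: vN0.
  by exists y.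
have [v [y [Rv _ ->]]] := resR x (genV x).
case: (EM (exists y, v = y *+ D)) => [[z ->]|vN0].
  by left; exists (z + y); rewrite mulrnDl.
right; exists v, y; split=> //; rewrite mem_filter Rv andbT.
exact/asboolPn.
Qed.

(** If x = y *+ (m * e) is in the kernel, then f (y) is torsion, so m y is in
    the kernel too: the kernel is divisible by e, hence torsion. But m kills
    the torsion of V, and x is a multiple of m. *)
Lemma injective_mod_multiples (V W : zmodType) (f : {additive V -> W})
    (g : seq V) (S : seq V) m e :
    (forall x, span g x) -> (0 < m)%N -> (1 < e)%N ->
    (forall x : V, torsion x -> x *+ m = 0) ->
    (forall x : W, torsion x -> x *+ m = 0) ->
    (forall x, (exists y, x = y *+ (m * e)) \/
               exists v y, v \in S /\ x = v + y *+ (m * e)) ->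
    (forall v, v \in S -> forall y, y *+ (m * e) <> f v) ->
  injective f.
Proof.
move=> genV m0 e1 mV mW resS fS.
have me0 : (0 < m * e)%N by rewrite muln_gt0 m0 ltnW.
pose K a := f a = 0.
have sK : subgroup K.
  by split=> [|x y hx hy]; rewrite /K ?raddf0 // raddfB hx hy subrr.
have Kme a : K a -> exists2 y, a = y *+ (m * e) & K (y *+ m).
  move=> Ka; have [[y def_a]|[v [y [Sv def_a]]]] := resS a.
    exists y => //; rewrite /K raddfMn; apply: mW.
    by exists (m * e)%N; rewrite // -raddfMn -def_a.
  case: (fS v Sv (- f y)).
  rewrite mulNrn -raddfMn; apply/esym/eqP; rewrite -subr_eq0 opprK -raddfD.
  by rewrite -def_a; apply/eqP.
have tK a : K a -> torsion a.
  apply: (divisible_torsion genV sK e1) => {}a /Kme[y -> Ky].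
  by exists (y *+ m); rewrite // -mulrnA.
apply: raddf_inj => a /[dup] /Kme[y -> _] /tK/(torsion_mulrn me0)/mV y0.
by rewrite mulrnA y0 mul0rn.
Qed.

Lemma fin_gen_span (V : zmodType) :
  fin_gen_abelian V -> exists g : seq V, forall x, span g x.
Proof.
case=> n [v gen_v]; exists (codom v) => x; have [c ->] := gen_v x.
apply: subgroup_sum => [|i _]; first exact: span_subgroup.
by apply: subgroupMz; [apply: span_subgroup | apply/mem_span/codom_f].
Qed.

(** * Nilpotents modulo torsion and integral equations *)

Section Nilpotents.
Variable A : comPzRingType.
Implicit Types (x y a : A).

Lemma torsion_mul a x : torsion x -> torsion (a * x).
Proof. by case=> n n0 xn; exists n; rewrite // -mulrnAr xn mulr0. Qed.

(** The radical of the torsion ideal: A modulo [nilt] is the largest reduced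
    and torsion-free quotient of A. *)
Definition nilt x := exists k, torsion (x ^+ k).

(** Every term of the binomial expansion contains x ^+ i or y ^+ j. *)
Lemma torsion_exprD x y i j :
  torsion (x ^+ i) -> torsion (y ^+ j) -> torsion ((x + y) ^+ (i + j)).
Proof.
move=> tx ty; rewrite exprDn.
have sT := torsion_subgroup A.
apply: subgroup_sum => // l _; apply: subgroupMn => //.
have [lj|jl] := ltnP l j.
  have -> : (i + j - l = (i + j - l - i) + i)%N by lia.
  by rewrite exprD mulrAC; apply: torsion_mul.
by rewrite -(subnK jl) exprD mulrA; apply: torsion_mul.
Qed.

Lemma torsion_exprMl a x k : torsion (x ^+ k) -> torsion ((a * x) ^+ k).
Proof. by rewrite exprMn; apply: torsion_mul. Qed.

Lemma nilt_subgroup : subgroup nilt.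
Proof.
split; first by exists 1%N; apply: subgroup0 (torsion_subgroup A).
move=> x y [i xi] [j yj]; exists (i + j)%N; apply: torsion_exprD => //.
by rewrite -mulN1r; apply: torsion_exprMl.
Qed.

Lemma nilt_mul a x : nilt x -> nilt (a * x).
Proof. by case=> k xk; exists k; apply: torsion_exprMl. Qed.

Lemma nilt_torsion x : torsion x -> nilt x.
Proof. by exists 1%N. Qed.

Lemma nilt_mulrn x n : (0 < n)%N -> nilt (x *+ n) -> nilt x.
Proof.
move=> n0 [k]; rewrite exprMn_n => /torsion_mulrn tx; exists k; apply: tx.
by rewrite expn_gt0 n0.
Qed.

Lemma nilt_expr x k : nilt (x ^+ k) -> nilt x.
Proof. by case=> l; rewrite -exprM; exists (k * l)%N. Qed.

Lemma span_nilt g : (forall x, x \in g -> nilt x) ->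
  exists k, forall x, span g x -> torsion (x ^+ k).
Proof.
elim: g => [|v g IHg] ng.
  by exists 1%N => x /= ->; apply: subgroup0 (torsion_subgroup A).
have [|k gk] := IHg; first by move=> u gu; apply: ng; rewrite inE gu orbT.
have [j vj] := ng v (mem_head v g).
exists (k + j)%N => x [z /gk xk]; rewrite -[x](subrK (v *~ z)).
by apply: torsion_exprD => //; rewrite -mulrzl; apply: torsion_exprMl.
Qed.

(** Evaluation is defined by hand because A may be the zero ring, over which
    polynomials do not form a nontrivial ring. *)
Definition peval x (p : {poly int}) := \sum_(i < size p) x ^+ i *~ p`_i.

Lemma pevalE x n (p : {poly int}) : (size p <= n)%N ->
  peval x p = \sum_(i < n) x ^+ i *~ p`_i.
Proof.
move=> pn; rewrite /peval (big_ord_widen n (fun i => x ^+ i *~ p`_i) pn).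
rewrite big_mkcond /=; apply: eq_bigr => i _; case: ltnP => // /(nth_default 0) ->.
by rewrite mulr0z.
Qed.

Lemma pevalB x : {morph peval x : p q / p - q}.
Proof.
move=> p q; pose n := maxn (size p) (size q).
rewrite !(@pevalE x n) ?leq_maxl ?leq_maxr ?(leq_trans (size_polyD _ _)) //.
  by rewrite -sumrB; apply: eq_bigr => i _; rewrite coefB mulrzBr.
by rewrite size_polyN.
Qed.

HB.instance Definition _ x := GRing.isZmodMorphism.Build _ _ (peval x) (pevalB x).

Lemma pevalD x p q : peval x (p + q) = peval x p + peval x q.
Proof. exact: raddfD. Qed.

Lemma pevalC x c : peval x c%:P = 1 *~ c.
Proof. by rewrite (@pevalE x 1) ?size_polyC_leq1 // big_ord1 coefC. Qed.

Lemma pevalMX x p : peval x (p * 'X) = peval x p * x.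
Proof.
rewrite (@pevalE x (size p).+1); last first.
  by have [->|p0] := eqVneq p 0; rewrite ?mul0r ?size_poly0 // size_mulX.
rewrite big_ord_recl coefMX mulr0z add0r mulr_suml; apply: eq_bigr => i _.
by rewrite coefMX /= exprSr mulrzAl.
Qed.

Lemma pevalM x p q : peval x (p * q) = peval x p * peval x q.
Proof.
elim/poly_ind: p => [|p c IHp]; first by rewrite mul0r raddf0 mul0r.
rewrite mulrDl !pevalD mulrAC !pevalMX IHp mulrDl pevalC mulrAC; congr (_ + _).
by rewrite mulrzl mul_polyC -[c in LHS]intz scaler_int raddfMz.
Qed.

Lemma pevalX x : peval x 'X = x.
Proof. by rewrite -['X]mul1r pevalMX pevalC mulr1z mul1r. Qed.

Lemma pevalXn x n : peval x 'X^n = x ^+ n.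
Proof.
elim: n => [|n IHn]; first by rewrite expr0 pevalC mulr1z.
by rewrite exprSr pevalMX IHn exprSr.
Qed.

(** The subgroup Z[x] is finitely generated, hence spanned by polynomials in x
    of bounded degree, so a high power of x reduces to lower ones. *)
Lemma integral_equation g x : (forall y, span g y) ->
  exists N (p : {poly int}), (size p <= N)%N /\ x ^+ N = peval x p.
Proof.
move=> genA; pose P y := exists p, y = peval x p.
have sP : subgroup P.
  split; first by exists 0; rewrite raddf0.
  by move=> _ _ [p ->] [q ->]; exists (p - q); rewrite raddfB.
have [s sP' Ps] := subgroup_fin_gen sP (fun y _ => genA y).
have [N] : exists N, forall v, v \in s ->
    exists2 p : {poly int}, (size p <= N)%N & v = peval x p.
  elim: s sP' {Ps} => [|v s IHs] sP'; first by exists 0%N.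
  have [|N sN] := IHs; first by move=> u su; apply: sP'; rewrite inE su orbT.
  have [p def_v] := sP' v (mem_head v s).
  exists (maxn N (size p)) => u; rewrite inE => /predU1P[->|/sN[q qN ->]].
    by exists p; rewrite ?leq_maxr.
  by exists q; rewrite // (leq_trans qN) ?leq_maxl.
move=> sN; exists N.
have /Ps : P (x ^+ N) by exists 'X^N; rewrite pevalXn.
pose Q y := exists2 p : {poly int}, (size p <= N)%N & y = peval x p.
have sQ : subgroup Q.
  split; first by exists 0; rewrite ?size_poly0 ?raddf0.
  move=> _ _ [p pN ->] [q qN ->]; exists (p - q); last by rewrite raddfB.
  by rewrite (leq_trans (size_polyD _ _)) // geq_max size_polyN pN.
by case/(span_min sQ sN) => p; exists p.
Qed.

End Nilpotents.

(** * Reducedness modulo almost all primes *)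

Lemma int_deriv_neq0 (u : {poly int}) : (1 < size u)%N -> u^`() != 0.
Proof.
move=> u1; apply/eqP => u'0.
have := congr1 (fun p : {poly int} => p`_(size u).-2) u'0.
rewrite coef0 coef_deriv; apply/eqP; rewrite mulrn_eq0 /=.
rewrite (_ : (size u).-2.+1 = (size u).-1); last lia.
by rewrite -/(lead_coef u) lead_coef_eq0 -size_poly_gt0 ltnW.
Qed.

(** An annihilating polynomial of least degree is squarefree, because w ^ 2 | f
    makes (f / w) (x) nilpotent; in characteristic zero squarefree means
    separable, and clearing denominators in a Bezout relation gives d. *)
Lemma separable_annihilator (A : comPzRingType) (g : seq A) (x : A) :
  (forall y, span g y) -> exists (f u v : {poly int}) (d : int),
    [/\ d != 0, u * f + v * f^`() = d%:P & nilt (peval x f)].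
Proof.
move=> genA.
pose ann n := `[< exists f : {poly int},
  [/\ size f = n, f != 0 & nilt (peval x f)] >].
have ex_ann : exists n, ann n.
  have [N [p [pN xN]]] := integral_equation x genA.
  exists (size ('X^N - p)); apply/asboolP; exists ('X^N - p); split=> //.
    by apply: contraTneq pN => /subr0_eq <-; rewrite size_polyXn ltnn.
  by rewrite raddfB /= pevalXn xN subrr; apply: subgroup0 (nilt_subgroup A).
case: (ex_minnP ex_ann) => n /asboolP[f [fn f0 nf]] minn.
have sep_f : separable_poly f.
  apply/separable_polyP; split=> [u v uv_f|u _]; last exact: int_deriv_neq0.
  set w := gcdp u v.
  have ww_f : w * w %| f.
    by apply: dvdp_trans uv_f; apply: dvdp_mul; rewrite ?dvdp_gcdl ?dvdp_gcdr.
  have /Pdiv.Idomain.dvdpP[[c q] /= c0 cf] := ww_f.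
  have qww0 : q * (w * w) != 0 by rewrite -cf -mul_polyC mulf_neq0 ?polyC_eq0.
  have [q0 w0] : q != 0 /\ w != 0.
    by move: qww0; rewrite !mulf_eq0 !negb_or => /and3P[].
  have /minn : ann (size (q * w)).
    apply/asboolP; exists (q * w); split=> //; first by rewrite mulf_neq0.
    apply: (@nilt_expr _ _ 2); rewrite expr2 -pevalM.
    rewrite (_ : q * w * (q * w) = q * (q * (w * w))); last ring.
    rewrite -cf pevalM; apply: nilt_mul; rewrite -mul_polyC pevalM.
    exact: nilt_mul.
  have : size (c *: f) = size (q * (w * w)) by rewrite cf.
  rewrite -mul_polyC size_Cmul // fn mulrA size_mul ?mulf_neq0 // => ->.
  rewrite /coprimep -/w; move: (w0); rewrite -size_poly_gt0.
  have : (0 < size (q * w)%R)%N.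
    by rewrite size_poly_gt0 mulf_neq0.
  by lia.
rewrite unlock in sep_f.
have [u /Pdiv.Idomain.eqpP[[c1 c2] /= /andP[c10 c20]]] :=
  Pdiv.Idomain.Bezout_coprimepP _ _ sep_f.
rewrite scalerDr !scalerAl => def_c.
by exists f, (c1 *: u.1), (c1 *: u.2), c2; rewrite def_c alg_polyC.
Qed.

Section FiniteField.
Variables (F : finFieldType) (p : nat).
Hypothesis charFp : p \in [pchar F].

(** In a squarefree f, the factor f / gcd (f, h) is prime to gcd (f, h), hence
    to h; since it divides a power of h, it is constant. *)
Lemma separable_dvdp_expr (f h : {poly F}) n :
  separable_poly f -> f %| h ^+ n -> f %| h.
Proof.
move=> sep_f f_hn; have f0 := separable_poly_neq0 sep_f.
set w := gcdp f h; have wf : w %| f by apply: dvdp_gcdl.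
have def_f : f %/ w * w = f by rewrite divpK.
have co_fw : coprimep (f %/ w) w.
  by apply: (separable_coprime sep_f); rewrite def_f.
have co_fh : coprimep (f %/ w) h.
  apply/coprimepP => d d_fw d_h.
  have d_w : d %| w.
    by rewrite dvdp_gcd d_h andbT -def_f dvdp_mulr.
  exact: (coprimepP _ _ co_fw).
have : f %/ w %| h ^+ n.
  by apply: dvdp_trans f_hn; rewrite -{2}def_f dvdp_mulr.
rewrite -[h ^+ n]mul1r Gauss_dvdpl ?coprimep_expr // dvdp1 => /size_poly1P[c c0 fw].
have cV : c^-1%:P * f = w by rewrite -def_f fw mulrA -polyCM mulVf // mul1r.
by apply: dvdp_trans (dvdp_gcdr f h); rewrite -/w -cV dvdp_mull.
Qed.

(** By the pigeonhole principle two iterates X^(p^i) and X^(p^j) agree modulo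
    f, and their difference is a power of X^(p^(j-i)) - X. *)
Lemma separable_dvdp_frobenius (f : {poly F}) : separable_poly f ->
  exists2 e, (0 < e)%N & f %| 'X^(p ^ e) - 'X.
Proof.
move=> sep_f; have f0 := separable_poly_neq0 sep_f.
have p_pr := pcharf_prime charFp.
pose r i : 'rV[F]_(size f) := poly_rV ('X^(p ^ i) %% f).
have [i [j [lt_ij rij]]] : exists i j, (i < j)%N /\ r i = r j.
  pose r' (i : 'I_#|'rV[F]_(size f)|.+1) := r i.
  have /injectivePn[i [j neq_ij rij]] : ~~ injectiveb r'.
    by apply/negP => /injectiveP/leq_card; rewrite card_ord ltnn.
  wlog lt_ij : i j neq_ij rij / (i < j)%N.
    move=> IH; case: (ltngtP i j) => [lt_ij|lt_ij|/val_inj eq_ij].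
    - exact: IH lt_ij.
    - by apply: IH lt_ij => //; rewrite eq_sym.
    - by rewrite eq_ij eqxx in neq_ij.
  by exists i, j.
exists (j - i)%N; first by rewrite subn_gt0.
apply: (@separable_dvdp_expr _ _ (p ^ i)) => //.
have charX : [pchar {poly F}].-nat (p ^ i)%N.
  by rewrite pnatX pnatE // pchar_poly charFp.
rewrite exprDn_pchar // exprNn_pchar // -exprM -expnD subnK 1?ltnW //.
rewrite /dvdp modpD modpN.
move/(congr1 rVpoly): rij; rewrite !poly_rV_K; last 2 first.
- by have := ltn_modpN0 ('X^(p ^ j)) f0; exact: ltnW.
- by have := ltn_modpN0 ('X^(p ^ i)) f0; exact: ltnW.
by move=> ->; rewrite subrr.
Qed.
End FiniteField.

(** The Bezout relation stays a Bezout relation modulo p because p does not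
    divide d, so f is separable over 'F_p; the divisibility found there lifts
    back to integral polynomials up to multiples of p. *)
Lemma int_poly_modp (p : nat) (f u v : {poly int}) (d : int) : prime p ->
    ~~ (p%:Z %| d)%Z -> u * f + v * f^`() = d%:P ->
  exists e (K L : {poly int}), (0 < e)%N /\ 'X^(p ^ e) - 'X = K * f + L *+ p.
Proof.
move=> p_pr pNd Bez; have charFp := pchar_Fp p_pr.
pose red : {poly int} -> {poly 'F_p} := map_poly intr.
have redM : {morph red : x y / x * y} by apply: rmorphM.
have redB : {morph red : x y / x - y} by apply: rmorphB.
have redD : {morph red : x y / x + y} by apply: rmorphD.
have sep_f : separable_poly (red f).
  rewrite unlock; apply/Bezout_coprimepP; exists (red u, red v) => /=.
  rewrite deriv_map -/red -!redM -redD Bez /red map_polyC -polyC1 /=.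
  apply/eqpP; exists (1, d%:~R); last by rewrite scale1r alg_polyC.
  by rewrite oner_neq0 /= -(dvdz_pcharf charFp).
have [e e0 /dvdpP[k def_k]] := separable_dvdp_frobenius charFp sep_f.
pose K : {poly int} := map_poly (fun c : 'F_p => (c : nat)%:Z) k.
have redK : red K = k.
  apply/polyP => i; rewrite coef_map coef_map_id0 //=.
  by rewrite -[RHS](natr_Zp k`_i).
pose h := 'X^(p ^ e) - 'X - K * f.
have h0 : red h = 0.
  by rewrite /h !redB redM redK -def_k /red map_polyXn map_polyX subrr.
exists e, K, (\poly_(i < size h) (h`_i %/ p%:Z)%Z); split=> //.
apply/eqP; rewrite -subr_eq0 opprD addrA -/h subr_eq0; apply/eqP/polyP => i.
rewrite coefMn coef_poly; case: ltnP => [_|hi]; last first.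
  by rewrite nth_default // mul0rn.
have p_hi : (p%:Z %| h`_i)%Z.
  by rewrite (dvdz_pcharf charFp) -(coef_map intr) -/red h0 coef0.
by rewrite -mulr_natr natz divzK.
Qed.

Section ModuloPrime.
Variables (A : comPzRingType) (p : nat).
Hypothesis p_pr : prime p.
Implicit Types x y a : A.

(** The ideal p A + nilt A. *)
Definition pnilt x := exists a, nilt (x - a *+ p).

Lemma pnilt_subgroup : subgroup pnilt.
Proof.
split; first by exists 0; rewrite mul0rn subr0; apply: subgroup0 (nilt_subgroup A).
move=> x y [a nx] [b ny]; exists (a - b).
rewrite (_ : _ - _ = (x - a *+ p) - (y - b *+ p)); last first.
  by rewrite mulrnBl !opprB [LHS](AC (2*2) ((1*4)*(3*2)))%AC.
exact: subgroupB (nilt_subgroup A) nx ny.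
Qed.

Lemma pnilt_mul a x : pnilt x -> pnilt (a * x).
Proof.
by case=> b nx; exists (a * b); rewrite -mulrnAr -mulrBr; apply: nilt_mul.
Qed.

Lemma pnilt_mulp a : pnilt (a *+ p).
Proof. by exists a; rewrite subrr; apply: subgroup0 (nilt_subgroup A). Qed.

Lemma nilt_pnilt a : nilt a -> pnilt a.
Proof. by exists 0; rewrite mul0rn subr0. Qed.

Lemma pnilt_exprB x y n : pnilt (x - y) -> pnilt (x ^+ n - y ^+ n).
Proof. by move=> xy; rewrite subrXX mulrC; apply: pnilt_mul. Qed.

Lemma pnilt_trans y x z : pnilt (x - y) -> pnilt (y - z) -> pnilt (x - z).
Proof.
move=> xy yz; rewrite -[x](subrK y) -addrA; apply: subgroupD => //.
exact: pnilt_subgroup.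
Qed.

(** The inner binomial coefficients are divisible by p. *)
Lemma pnilt_frobeniusD x y : pnilt ((x + y) ^+ p - (x ^+ p + y ^+ p)).
Proof.
have [sJ p0] := (pnilt_subgroup, prime_gt0 p_pr).
rewrite exprDn -(prednK p0) big_ord_recl big_ord_recr /= subnn subn0.
rewrite !expr0 mulr1 mul1r bin0 !mulr1n /bump /= add1n prednK // binn mulr1n.
rewrite addrCA addrK.
apply: subgroup_sum => // i _.
have /dvdnP[q ->] : (p %| 'C(p, bump 0 i))%N.
  by rewrite prime_dvd_bin // /bump add1n /=; move: (ltn_ord i); lia.
by rewrite mulrnA; apply: pnilt_mulp.
Qed.

Lemma pnilt_iter_frobeniusD x y e :
  pnilt ((x + y) ^+ (p ^ e) - (x ^+ (p ^ e) + y ^+ (p ^ e))).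
Proof.
elim: e => [|e IHe].
  by rewrite expn0 !expr1 subrr; apply: subgroup0 pnilt_subgroup.
rewrite expnSr !exprM; apply: pnilt_trans (pnilt_frobeniusD _ _).
exact: pnilt_exprB.
Qed.

(** Fixed by the e-th iterate of Frobenius in A modulo p A + nilt A. *)
Definition frobenius_fixed e x := pnilt (x ^+ (p ^ e) - x).

Lemma frobenius_fixedM e k x :
  frobenius_fixed e x -> frobenius_fixed (e * k) x.
Proof.
rewrite /frobenius_fixed => fx; elim: k => [|k IHk].
  by rewrite muln0 expr1 subrr; apply: subgroup0 pnilt_subgroup.
rewrite mulnS expnD exprM; apply: pnilt_trans IHk; exact: pnilt_exprB.
Qed.

Lemma frobenius_fixedD e x y : frobenius_fixed e x -> frobenius_fixed e y ->
  frobenius_fixed e (x + y).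
Proof.
move=> fx fy; apply: pnilt_trans (pnilt_iter_frobeniusD x y e) _.
by rewrite opprD addrACA; apply: subgroupD => //; apply: pnilt_subgroup.
Qed.

Lemma frobenius_fixed_subgroup :
  subgroup (fun x => exists2 e, (0 < e)%N & frobenius_fixed e x).
Proof.
have sJ := pnilt_subgroup; have p0 := prime_gt0 p_pr.
have fixD x y e e' : (0 < e)%N -> frobenius_fixed e x -> (0 < e')%N ->
    frobenius_fixed e' y ->
    exists2 e, (0 < e)%N & frobenius_fixed e (x + y).
  move=> e0 fx e0' fy; exists (e * e')%N; first by rewrite muln_gt0 e0.
  by apply: frobenius_fixedD; last rewrite mulnC; apply: frobenius_fixedM.
have fix0 : frobenius_fixed 1 0.
  by rewrite /frobenius_fixed expn1 expr0n gtn_eqF // subrr; apply: subgroup0 sJ.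
have fixMn x e n : (0 < e)%N -> frobenius_fixed e x -> frobenius_fixed e (x *+ n).
  move=> e0 fx; elim: n => [|n IHn]; last by rewrite mulrS; apply: frobenius_fixedD.
  by rewrite mulr0n -[e]mul1n; apply: frobenius_fixedM.
split; first by exists 1%N.
move=> x y [e e0 fx] [e' e0' fy]; apply: fixD (e0) fx (e0') _.
(* modulo p, negation is multiplication by p - 1 *)
have yp : pnilt (- y - y *+ p.-1).
  rewrite -opprD -mulrS prednK //; apply: subgroupN => //; exact: pnilt_mulp.
have yp' : pnilt (y *+ p.-1 - (- y)) by rewrite -opprB; apply: subgroupN.
apply: pnilt_trans yp'; apply: pnilt_trans (fixMn y e' p.-1 e0' fy).
exact: pnilt_exprB.
Qed.

(** A fixed point y of an iterate of Frobenius cannot be a nonzero nilpotent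
    of the quotient: it is congruent to its own arbitrarily high powers. *)
Lemma frobenius_fixed_reduced y N : (exists2 e, (0 < e)%N & frobenius_fixed e y) ->
  pnilt (y ^+ N) -> pnilt y.
Proof.
case=> e e0 fy nyN.
have NpeN : (N <= p ^ (e * N))%N.
  apply: leq_trans (ltnW (ltn_expl N (prime_gt1 p_pr))) _.
  by rewrite leq_exp2l ?prime_gt1 // leq_pmull.
have := frobenius_fixedM N fy; rewrite /frobenius_fixed -(subnK NpeN) exprD.
move=> fyN; rewrite -[y]opprK; apply: subgroupN; first exact: pnilt_subgroup.
rewrite -[- y](addKr (y ^+ (p ^ (e * N) - N) * y ^+ N)).
apply: subgroupD => //; first exact: pnilt_subgroup.
by apply: subgroupN; [apply: pnilt_subgroup | apply: pnilt_mul].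
Qed.
End ModuloPrime.

(** A modulo nilpotents and torsion stays reduced modulo every prime p outside
    a finite set. Each of the finitely many generators satisfies a separable
    polynomial; if p divides none of the integers d of the Bezout relations,
    each generator is fixed by an iterate of Frobenius modulo p, hence so is
    every element, because Frobenius is additive modulo p. *)
Lemma almost_all_primes_reduced (A : comPzRingType) (g : seq A) :
    (forall y, span g y) ->
  exists2 D, (0 < D)%N & forall p (y : A) N, prime p -> ~~ (p %| D)%N ->
    pnilt p (y ^+ N) -> pnilt p y.
Proof.
move=> genA.
have [D D0 HD] : exists2 D, (0 < D)%N & forall p x, prime p -> ~~ (p %| D)%N ->
    x \in g -> exists2 e, (0 < e)%N & frobenius_fixed p e x.
  elim: (g) => [|a s [D D0 HD]]; first by exists 1%N.
  have [f [u [v [d [d0 Bez nf]]]]] := separable_annihilator a genA.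
  exists (`|d| * D)%N; first by rewrite muln_gt0 D0 absz_gt0 d0.
  move=> p x p_pr pND; rewrite inE => /predU1P[->|]; last first.
    by apply: HD => //; apply: contra pND; apply: dvdn_mull.
  have pNd : ~~ (p%:Z %| d)%Z by apply: contra pND; apply: dvdn_mulr.
  have [e [K [L [e0 def_X]]]] := int_poly_modp p_pr pNd Bez.
  exists e => //; have := congr1 (peval a) def_X.
  rewrite raddfB /= pevalXn pevalX pevalD pevalM raddfMn => def_a.
  rewrite /frobenius_fixed def_a; apply: subgroupD.
  - exact: pnilt_subgroup.
  - exact/nilt_pnilt/nilt_mul.
  - exact: pnilt_mulp.
exists D => // p y N p_pr pND; apply: frobenius_fixed_reduced => //.
by apply: (span_min (frobenius_fixed_subgroup A p_pr) _ (genA y)) => x; apply: HD.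
Qed.

(** * Finitely many first-order conditions that force bijectivity *)

Section ScaleSpan.
Variables (S : pzRingType) (U : zmodType) (op : S -> U -> U).
Hypothesis opB : forall a b v, op (a - b) v = op a v - op b v.
Hypothesis op_int : forall z v, op z%:~R v = v *~ z.

(** Generation by scalars of a sort of the language: for op = *%R this is an
    ideal, for op = *:%R a submodule. Peeling off one generator at a time makes
    it expressible by nested existential quantifiers. *)
Fixpoint scale_span (s : seq U) (x : U) : Prop :=
  if s is v :: s' then exists a : S, scale_span s' (x - op a v) else x = 0.

Lemma scale_span_subgroup s : subgroup (scale_span s).
Proof.
have op0 v : op 0 v = 0 by rewrite -[X in op X](subrr 0) opB subrr.
elim: s => [|v s [s0 sB]] /=.
  by split=> // x y -> ->; rewrite subr0.
split; first by exists 0; rewrite op0 subrr.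
move=> x y [a sx] [b sy]; exists (a - b); rewrite opB.
have -> : x - y - (op a v - op b v) = (x - op a v) - (y - op b v).
  by rewrite !opprB [LHS](AC (2*2) ((1*4)*(3*2)))%AC.
exact: sB.
Qed.

Lemma span_scale_span s x : span s x -> scale_span s x.
Proof.
elim: s x => //= v s IHs x [z /IHs sx].
by exists z%:~R; rewrite op_int.
Qed.

(** The two conditions say, without quantifying over integers, that m U is
    torsion free. The first excludes 2-torsion in m U. For an odd integer
    n = 1 + 2 j the second, with the scalar y = j, shows that an element of m U
    killed by n is zero. *)
Lemma torsion_of_test m :
    (forall x : U, x *+ m *+ 2 = 0 -> x *+ m = 0) ->
    (forall (x : U) (y : S), x *+ m + op y (x *+ m) *+ 2 = 0 -> x *+ m = 0) ->
  forall x : U, torsion x -> x *+ m = 0.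
Proof.
move=> test2 test_odd x [n n0 xn].
have {xn} : x *+ m *+ n = 0 by rewrite mulrnAC xn mul0rn.
elim/ltn_ind: n x n0 => n IHn x n0 xmn.
have op_nat j v : op j%:R v = v *+ j by rewrite -[j%:R]/(j%:Z%:~R) op_int.
have := odd_double_half n; case: (odd n) => /= def_n.
  apply: (test_odd x (n./2)%:R).
  move: (x *+ m) xmn => t tn.
  by rewrite op_nat -mulrnA muln2 -mulrS -add1n def_n.
apply: (IHn n./2); [by lia | by lia |].
rewrite mulrnAC; apply: test2.
by rewrite [_ *+ m]mulrnAC -[LHS]mulrnA muln2 -[_.*2]add0n def_n.
Qed.

End ScaleSpan.

Lemma mul_int (A : pzRingType) (z : int) (v : A) : z%:~R * v = v *~ z.
Proof. by rewrite mulrzl. Qed.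

Lemma scale_span_mul (B : comPzRingType) (b x : B) s :
  scale_span *%R s x -> scale_span *%R s (b * x).
Proof.
elim: s x => [|v s IHs] x /= => [->|[a /IHs sx]]; first by rewrite mulr0.
by exists (b * a); rewrite -mulrA -mulrBr.
Qed.

(** Modulo torsion elements that lie in the image anyway, the ideal generated
    by h (v) is nilpotent, so it may be dropped from any generating set of B
    over the image of h: substituting x = x0 + y h (v) into itself pushes y to
    higher and higher powers of h (v). *)
Lemma rmorph_surj_mod_nil (A B : comPzRingType) (h : {rmorphism A -> B}) s :
    (forall v, v \in s -> nilt v) ->
    (forall x : B, torsion x -> exists a, x = h a) ->
    (forall x : B, exists a, scale_span *%R (map h s) (x - h a)) ->
  forall x : B, exists a, x = h a.
Proof.
move=> + imT; elim: s => [|v s IHs] ns surj /=.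
  by move=> x; have [a /subr0_eq ->] := surj x; exists a.
apply: IHs => [u su|]; first by apply: ns; rewrite inE su orbT.
pose X x := exists a, scale_span *%R (map h s) (x - h a).
have sS : subgroup (scale_span *%R (map h s)).
  by apply: scale_span_subgroup => a b u; rewrite mulrBl.
have X0 a : X (h a) by exists a; rewrite subrr; apply: subgroup0.
have XD x y : X x -> X y -> X (x + y).
  move=> [a sx] [b sy]; exists (a + b); rewrite rmorphD opprD addrACA.
  exact: subgroupD.
have XM a x : X x -> X (h a * x).
  by move=> [b sx]; exists (a * b); rewrite rmorphM -mulrBr; apply: scale_span_mul.
have step j x : exists y, X (x - y * h v ^+ j).
  elim: j => [|j [y Xy]].
    by exists x; rewrite mulr1 subrr -(rmorph0 h); apply: X0.
  have [a [y' sy]] := surj y; exists y'.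
  have -> : x - y' * h v ^+ j.+1
      = (x - y * h v ^+ j) + h (v ^+ j) * (y - y' * h v).
    by rewrite rmorphXn exprS; ring.
  by apply: XD => //; apply: XM; exists a; rewrite addrAC.
have [j vj] := ns v (mem_head v s).
move=> x; have [y Xy] := step j x.
have [a def_a] : exists a, y * h v ^+ j = h a.
  apply: imT; apply: torsion_mul; rewrite -rmorphXn.
  by case: vj => n n0 vn; exists n; rewrite // -rmorphMn vn rmorph0.
by rewrite def_a in Xy; rewrite -[x](subrK (h a)); apply: XD.
Qed.

Lemma nilt_rmorph (A B : comPzRingType) (h : {rmorphism A -> B}) a :
  nilt a -> nilt (h a).
Proof.
case=> k [n n0 an]; exists k, n => //.
by rewrite -rmorphXn -rmorphMn an rmorph0.
Qed.

(** Since t = - 2 y t, the subgroup Z[y] t is divisible by 2. *)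
Lemma odd_multiple_torsion (A : comPzRingType) (U : lmodType A) (g : seq U)
    (y : A) (t : U) :
  (forall x, span g x) -> t + y *: t *+ 2 = 0 -> torsion t.
Proof.
move=> genU ty.
have sP : subgroup (fun z => exists p : {poly int}, z = peval y p *: t).
  split; first by exists 0; rewrite raddf0 scale0r.
  by move=> _ _ [p ->] [q ->]; exists (p - q); rewrite raddfB scalerBl.
apply: (divisible_torsion genU sP (isT : (1 < 2)%N)) => [_ [p ->]|].
  exists (peval y (- p * 'X) *: t); first by exists (- p * 'X).
  rewrite pevalMX raddfN /= mulNr scaleNr mulNrn -scalerA scalerMnr.
  by apply/eqP; rewrite -addr_eq0 -scalerDr ty scaler0.
by exists 1%:P; rewrite pevalC scale1r.
Qed.

Section RingTest.
Variable A : comPzRingType.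

(** What the conditions on h : A -> B need to know about A. Here m is an
    exponent of the torsion, k a bound for nilpotency modulo torsion, and D a
    multiple of m and of the primes p for which A modulo p A + nilt A is not
    reduced. The lists are the torsion elements, generators of the ideal
    [nilt], representatives of A modulo D, and representatives of the nonzero
    classes modulo D. *)
Record ring_data := RingData {
  rd_m : nat; rd_k : nat; rd_D : nat;
  rd_torsion : seq A; rd_nil : seq A; rd_residues : seq A; rd_nonzero : seq A
}.

Record ring_data_ok (d : ring_data) : Prop := RingDataOk {
  ok_m : (0 < rd_m d)%N;
  ok_torsion : forall x : A, torsion x -> x *+ rd_m d = 0;
  ok_k : (0 < rd_k d)%N;
  ok_D : exists2 e, (1 < e)%N & rd_D d = (rd_m d * e)%N;
  ok_nil : forall v, v \in rd_nil d -> nilt v;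
  ok_nonzero : forall x : A, (exists y, x = y *+ rd_D d) \/
    exists v y, v \in rd_nonzero d /\ x = v + y *+ rd_D d;
  ok_prime : forall p (y : A) N, prime p -> ~~ (p %| rd_D d)%N ->
    pnilt p (y ^+ N) -> pnilt p y
}.

(** The conditions on h that will be written in the language. The fields up to
    [rt_exponent] make the torsion and the radical of B definable uniformly, as
    the sets of x with m x = 0 and with m x ^+ k = 0; the next two say that
    both are generated by the image of A; the last two say that h is surjective
    modulo D up to the radical, and injective modulo D. *)
Record ring_test (d : ring_data) (B : comPzRingType) (h : A -> B) : Prop :=
  RingTest {
  rt_two : forall x : B, x *+ rd_m d *+ 2 = 0 -> x *+ rd_m d = 0;
  rt_odd : forall x y : B,
    x *+ rd_m d + y * (x *+ rd_m d) *+ 2 = 0 -> x *+ rd_m d = 0;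
  rt_exponent : forall x : B,
    x ^+ (rd_k d + rd_k d) *+ rd_m d = 0 -> x ^+ rd_k d *+ rd_m d = 0;
  rt_torsion : forall x : B, x *+ rd_m d = 0 ->
    exists2 v, v \in rd_torsion d & x = h v;
  rt_nil : forall x : B, x ^+ rd_k d *+ rd_m d = 0 ->
    scale_span *%R (map h (rd_nil d)) x;
  rt_residues : forall x : B, exists2 v, v \in rd_residues d &
    exists y w, x = h v + y *+ rd_D d + w /\ w ^+ rd_k d *+ rd_m d = 0;
  rt_nonzero : forall v, v \in rd_nonzero d -> forall y : B, y *+ rd_D d <> h v
}.

Lemma ring_data_exists (g : seq A) : (forall x, span g x) ->
  exists2 d, ring_data_ok d & ring_test d id.
Proof.
move=> genA.
have [m m0 mT] := torsion_exponent genA.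
have [D0 D0_gt0 D0P] := almost_all_primes_reduced genA.
have [I nI genI] := subgroup_fin_gen (nilt_subgroup A) (fun x _ => genA x).
have [k0 kI] := span_nilt nI; pose k := k0.+1.
have kN (x : A) : nilt x -> x ^+ k *+ m = 0.
  by move/genI/kI => xk; apply: mT; rewrite exprS; apply: torsion_mul.
have [T0 tT0 genT] := subgroup_fin_gen (torsion_subgroup A) (fun x _ => genA x).
have [T [_ resT]] := span_residues T0 m0.
pose D := (m * (2 * D0))%N; have D_gt0 : (0 < D)%N by lia.
have [R [_ resR]] := span_residues g D_gt0.
have [S [SN0 resS]] := nonzero_residues genA D_gt0.
exists (RingData m k D T I R S); split=> //=.
- by exists (2 * D0)%N => //; lia.
- move=> p y N p_pr pND; apply: D0P => //; apply: contra pND => /dvdn_mull.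
  by move/(_ 2%N)/dvdn_mull; apply.
- by move=> x xm; apply: mT; exists (m * 2)%N; rewrite ?muln_gt0 ?m0 // mulrnA.
- move=> x y xy; suff : torsion (x *+ m) by move/(torsion_mulrn m0)/mT.
  exact: (@odd_multiple_torsion A A^o g y).
- move=> x xk; apply/kN/(@nilt_expr _ _ (k + k))/nilt_torsion.
  by exists m.
- move=> x xm; have [|v [y [Tv ty ->]]] := resT x.
    by apply: genT; exists m.
  exists v => //; have /mT-> : torsion y; last by rewrite addr0.
  exact: (span_min (torsion_subgroup A) tT0 ty).
- move=> x xk; rewrite map_id; apply: (span_scale_span (@mul_int A)).
  by apply: genI; apply/(@nilt_expr _ _ k)/nilt_torsion; exists m.
- move=> x; have [v [y [Rv _ ->]]] := resR x (genA x).
  exists v => //; exists y, 0; rewrite addr0; split=> //.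
  exact/kN/(subgroup0 (nilt_subgroup A)).
Qed.

Variables (g : seq A) (d : ring_data) (B : comPzRingType) (h : {rmorphism A -> B}).
Hypotheses (genA : forall x, span g x) (d_ok : ring_data_ok d) (h_test : ring_test d h).
Local Notation m := (rd_m d).
Local Notation k := (rd_k d).
Local Notation D := (rd_D d).

Lemma ring_test_torsion x : torsion x -> x *+ m = 0 :> B.
Proof.
apply: (torsion_of_test (@mul_int B)); first exact: rt_two h_test.
exact: rt_odd h_test.
Qed.

(** Repeated squaring lowers an exponent k 2 ^ i down to k by [rt_exponent]. *)
Lemma ring_test_nilt x : nilt x -> x ^+ k *+ m = 0 :> B.
Proof.
case=> j xj; have {}xj : x ^+ (k + j) *+ m = 0.
  by apply: ring_test_torsion; rewrite exprD; apply: torsion_mul.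
have expand i : (x ^+ (k * 2 ^ i)) *+ m = 0 -> x ^+ k *+ m = 0.
  elim: i => [|i IHi]; first by rewrite muln1.
  have -> : (k * 2 ^ i.+1 = 2 ^ i * (k + k))%N by rewrite expnS; lia.
  by rewrite exprM => /(rt_exponent h_test); rewrite -exprM mulnC.
apply: (expand (k + j)%N).
have k0 := ok_k d_ok.
have le_kj : (k + j <= k * 2 ^ (k + j))%N.
  by apply: leq_trans (ltnW (ltn_expl _ (ltnSn 1))) _; rewrite leq_pmull.
by rewrite -(subnK le_kj) exprD -mulrnAr xj mulr0.
Qed.

(** Injectivity modulo D lifts to injectivity. *)
Lemma ring_test_inj : injective h.
Proof.
have [e e1 def_D] := ok_D d_ok; have := rt_nonzero h_test.
have := ok_nonzero d_ok; rewrite def_D.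
apply: (injective_mod_multiples genA (ok_m d_ok) e1 (ok_torsion d_ok)).
exact: ring_test_torsion.
Qed.

Lemma ring_test_nilt_inj a : nilt (h a) -> nilt a.
Proof.
move=> /ring_test_nilt; rewrite -rmorphXn -rmorphMn -(rmorph0 h).
move/ring_test_inj => am; exists k; exists m => //; exact: ok_m d_ok.
Qed.

(** Let L be the preimage in B of the image of A modulo the radical. Surjectivity
    modulo D makes the index of L prime to D, and at a prime p not dividing D
    the ring L is p-maximal because A is reduced modulo p. So L = B, and the
    radical is recovered from its generators, which lie in the image. *)
Lemma ring_test_surj (gB : seq B) :
  (forall x, span gB x) -> forall x, exists a, x = h a.
Proof.
move=> genB.
have m0 := ok_m d_ok.
pose L x := exists a, nilt (x - h a).
have sN := nilt_subgroup B.
have sL : subgroup L.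
  split; first by exists 0; rewrite rmorph0 subrr; apply: subgroup0 sN.
  move=> x y [a xa] [b yb]; exists (a - b).
  rewrite rmorphB (_ : _ - _ = (x - h a) - (y - h b)); last by ring.
  exact: subgroupB.
have [n con nL] : exists2 n, coprimez n D & forall x, span gB x -> L (x *~ n).
  apply: (span_nakayama sL) => x _.
  have [v _ [y [w [-> wk]]]] := rt_residues h_test x.
  exists y => //; exists v; rewrite -pmulrn.
  rewrite (_ : _ - _ = w); last by ring.
  by exists k; exists m.
(* p-maximality: let p x be h y modulo nilpotents and let x ^+ N = r (x) with r
   of degree < N. Then h y ^+ N is congruent to p ^ N r (x), which is p h (z)
   modulo nilpotents for the element z below. So y is nilpotent modulo p, hence
   y = p a modulo nilpotents, and x is h a modulo nilpotents. *)
have maxp p x : prime p -> ~~ (p %| D)%N -> L (x *+ p) -> L x.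
  move=> p_pr pND [y nxy].
  have [N [r [rN xN]]] := integral_equation x genB.
  pose z := \sum_(j < N) y ^+ j *~ r`_j *+ p ^ (N - j).-1.
  have nz : nilt (y ^+ N - z *+ p).
    apply: ring_test_nilt_inj.
    have congr j : nilt (h y ^+ j - x ^+ j *+ p ^ j).
      rewrite -exprMn_n subrXX mulrC; apply: nilt_mul.
      by rewrite -opprB; apply: subgroupN.
    rewrite rmorphB rmorphXn -[h y ^+ N](subrK (x ^+ N *+ p ^ N)) -addrA.
    apply: subgroupD => //.
    rewrite xN (pevalE _ rN) rmorphMn rmorph_sum -!sumrMnl -sumrB.
    apply: subgroup_sum => // j _.
    rewrite rmorphMn rmorphMz rmorphXn -mulrnA -expnSr prednK ?subn_gt0 //.
    have -> : x ^+ j *~ r`_j *+ p ^ N = x ^+ j *+ p ^ j *~ r`_j *+ p ^ (N - j).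
      rewrite !pmulrn -!mulrzA; congr (_ *~ _).
      by rewrite [RHS]mulrCA -PoszM -expnD subnKC // ltnW.
    rewrite -mulrnBl -mulrzBl.
    apply: subgroupMn => //; apply: subgroupMz => //.
    by rewrite -opprB; apply: subgroupN.
  have [a nya] : pnilt p y.
    by apply: (ok_prime d_ok p_pr pND (N := N)); exists z.
  exists a; apply: (nilt_mulrn (prime_gt0 p_pr)).
  have -> : (x - h a) *+ p = (x *+ p - h y) + h (y - a *+ p).
    by rewrite rmorphB rmorphMn; ring.
  by apply: subgroupD => //; apply: nilt_rmorph.
have {n con nL} Lx x : L x.
  have [n' con' nL'] : exists2 n', coprime n' D & L (x *+ n').
    exists `|n|%N; first by move: con; rewrite coprimezE.
    have [nE|nE] : `|n|%N = n :> int \/ `|n|%N = - n :> int by lia.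
      by rewrite pmulrn nE; apply: nL.
    by rewrite pmulrn nE mulrNz; apply: subgroupN => //; apply: nL.
  (* cancel the prime factors of n' one at a time *)
  elim/ltn_ind: n' con' nL' => n' IHn con' nL'.
  have [n1|n1] := leqP n' 1.
    case: n' n1 con' nL' {IHn} => [|[|//]] _; last by rewrite mulr1n.
    have [e e1 ->] := ok_D d_ok; rewrite /coprime gcd0n => me1.
    by have := ok_m d_ok; move: e1 me1; lia.
  have p_pr := pdiv_prime n1; have p_n' := pdiv_dvd n'.
  apply: (IHn (n' %/ pdiv n')%N).
  - by rewrite ltn_Pdiv ?prime_gt1 // ltnW.
  - by apply: coprime_dvdl con'; apply: dvdn_div.
  apply: (maxp (pdiv n')) => //; last by rewrite -mulrnA divnK.
  rewrite -prime_coprime //; exact: coprime_dvdl con'.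
apply: (rmorph_surj_mod_nil (s := rd_nil d)).
- exact: ok_nil d_ok.
- move=> x /ring_test_torsion/(rt_torsion h_test)[v _ ->]; by exists v.
move=> x; have [a /ring_test_nilt/(rt_nil h_test) xa] := Lx x.
by exists a.
Qed.
End RingTest.

Section ModuleTest.
Variables (A : comPzRingType) (C : lmodType A).

(** The module needs fewer conditions: its generators over the scalars settle
    surjectivity once the scalars are known to be in the image. *)
Record module_data := ModuleData {
  md_m : nat; md_gens : seq C; md_nonzero : seq C
}.

Record module_data_ok (d : module_data) : Prop := ModuleDataOk {
  okm_m : (0 < md_m d)%N;
  okm_torsion : forall x : C, torsion x -> x *+ md_m d = 0;
  okm_nonzero : forall x : C, (exists y, x = y *+ (md_m d * 2)) \/
    exists v y, v \in md_nonzero d /\ x = v + y *+ (md_m d * 2)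
}.

Record module_test (d : module_data) (B : comPzRingType) (U : lmodType B)
    (f : C -> U) : Prop := ModuleTest {
  mt_two : forall x : U, x *+ md_m d *+ 2 = 0 -> x *+ md_m d = 0;
  mt_odd : forall (x : U) (y : B),
    x *+ md_m d + y *: (x *+ md_m d) *+ 2 = 0 -> x *+ md_m d = 0;
  mt_gens : forall x : U, scale_span *:%R (map f (md_gens d)) x;
  mt_nonzero : forall v, v \in md_nonzero d ->
    forall y : U, y *+ (md_m d * 2) <> f v
}.

Lemma module_data_exists (g : seq C) : (forall x, span g x) ->
  exists2 d, module_data_ok d & module_test d id.
Proof.
move=> genC; have [m m0 mT] := torsion_exponent genC.
have m2 : (0 < m * 2)%N by lia.
have [S [SN0 resS]] := nonzero_residues genC m2.
exists (ModuleData m g S); split=> //=.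
- by move=> x xm; apply: mT; exists (m * 2)%N; rewrite // mulrnA.
- move=> x y /(odd_multiple_torsion genC)/(torsion_mulrn m0); exact: mT.
- move=> x; rewrite map_id; apply: span_scale_span (genC x).
  by move=> z v; rewrite scaler_int.
Qed.

Variables (g : seq C) (d : module_data) (B : comPzRingType) (U : lmodType B).
Variables (h : {rmorphism A -> B}) (f : {additive C -> U}).
Hypotheses (genC : forall x, span g x) (d_ok : module_data_ok d).
Hypotheses (f_test : module_test d f) (fZ : forall a x, f (a *: x) = h a *: f x).

Lemma module_test_inj : injective f.
Proof.
have := mt_nonzero f_test; have := okm_nonzero d_ok.
apply: (injective_mod_multiples genC (okm_m d_ok) (isT : (1 < 2)%N)
         (okm_torsion d_ok)).
apply: (@torsion_of_test B U *:%R); first by move=> z v; rewrite scaler_int.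
  exact: mt_two f_test.
exact: mt_odd f_test.
Qed.

Lemma module_test_surj :
  (forall b, exists a, b = h a) -> forall x, exists c, x = f c.
Proof.
move=> h_surj x; have := mt_gens f_test x.
elim: (md_gens d) x => [|v s IHs] x /= => [->|[b /IHs[c def_c]]].
  by exists 0; rewrite raddf0.
have [a def_b] := h_surj b; exists (c + a *: v).
by rewrite raddfD /= fZ -def_b -def_c subrK.
Qed.
End ModuleTest.

(** * Generators and relations *)

Section Presentation.
Variable V : zmodType.

Definition lin n (b : nat -> V) (c : 'rV[int]_n) : V :=
  \sum_(i < n) b i *~ c 0 i.

Lemma linB n b : {morph @lin n b : c c' / c - c'}.
Proof.
move=> c c'; rewrite /lin -sumrB; apply: eq_bigr => i _.
by rewrite !mxE mulrzBr.
Qed.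

Lemma lin_kernel n b : subgroup (fun c : 'rV[int]_n => lin b c = 0).
Proof.
split; first by rewrite /lin big1 // => i _; rewrite mxE mulr0z.
by move=> c c' hc hc'; rewrite linB hc hc' subrr.
Qed.

Lemma lin_delta n b (i : 'I_n) : lin b (delta_mx 0 i) = b i.
Proof.
rewrite /lin (bigD1 i) //= big1 => [|j neq_ji]; rewrite mxE eqxx /=.
  by rewrite eqxx addr0.
by rewrite (negPf neq_ji).
Qed.

Lemma row_span n (c : 'rV[int]_n) : span [seq delta_mx 0 i | i <- enum 'I_n] c.
Proof.
rewrite [c]row_sum_delta; have sS := span_subgroup.
apply: subgroup_sum => // i _; rewrite -[c 0 i]intz scaler_int.
apply: subgroupMz => //; apply/mem_span/map_f; exact: mem_enum.
Qed.

Lemma relations_fin_gen n b : exists R : seq 'rV[int]_n,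
  (forall r, r \in R -> lin b r = 0) /\ forall c, lin b c = 0 -> span R c.
Proof.
have [R R0 genR] := subgroup_fin_gen (lin_kernel n b) (fun c _ => row_span c).
by exists R.
Qed.

End Presentation.

(** The generators a of V may be sent to any elements b of W that satisfy the
    relations R: the map does not depend on the choice of coordinates co,
    because two choices differ by a relation. *)
Lemma lin_extends (V W : zmodType) n (a : nat -> V) (b : nat -> W)
    (R : seq 'rV[int]_n) (co : V -> 'rV[int]_n) :
    (forall x, x = lin a (co x)) ->
    (forall c, lin a c = 0 -> span R c) -> (forall r, r \in R -> lin b r = 0) ->
  {morph (fun x => lin b (co x)) : x y / x - y} /\
  forall i : 'I_n, lin b (co (a i)) = b i.
Proof.
move=> coK genR Rb.
have wd (c c' : 'rV[int]_n) : lin a c = lin a c' -> lin b c = lin b c'.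
  move=> cc'; apply/eqP; rewrite -subr_eq0 -linB; apply/eqP.
  apply: (span_min (lin_kernel n b) Rb); apply: genR.
  by rewrite linB cc' subrr.
split=> [x y|i]; last by rewrite -[RHS]lin_delta; apply: wd; rewrite -coK lin_delta.
by rewrite /= -linB; apply: wd; rewrite linB -!coK.
Qed.

(** * Formulas, isomorphisms and existential closure *)

Section IsomorphismInvariance.
Variables (M N : two_sorted_algebra).
Variables (f : {additive carrier M -> carrier N}).
Variables (g : {rmorphism scalar M -> scalar N}).
Hypotheses (f_bij : bijective f) (g_bij : bijective g).
Hypotheses (fM : forall x y, f (amul x y) = amul (f x) (f y)).
Hypotheses (fZ : forall a x, f (a *: x) = g a *: f x).

Lemma ceval_iso t ec ec' : {in cterm_vars t, forall n, ec' n = f (ec n)} ->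
  ceval ec' t = f (ceval ec t).
Proof.
elim: t => [n||t1 IH1 t2 IH2|t1 IH1 t2 IH2] /= eq_e.
- by rewrite eq_e ?mem_head.
- by rewrite raddf0.
- by rewrite raddfD IH1 ?IH2 // => n tn; apply: eq_e; rewrite mem_cat tn ?orbT.
- by rewrite fM IH1 ?IH2 // => n tn; apply: eq_e; rewrite mem_cat tn ?orbT.
Qed.

Lemma aeval_iso t ea ea' : {in aterm_vars t, forall n, ea' n = g (ea n)} ->
  aeval ea' t = g (aeval ea t).
Proof.
elim: t => [n|||t1 IH1 t2 IH2|t1 IH1 t2 IH2] /= eq_e.
- by rewrite eq_e ?mem_head.
- by rewrite rmorph0.
- by rewrite rmorph1.
- by rewrite rmorphD IH1 ?IH2 // => n tn; apply: eq_e; rewrite mem_cat tn ?orbT.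
- by rewrite rmorphM IH1 ?IH2 // => n tn; apply: eq_e; rewrite mem_cat tn ?orbT.
Qed.

Lemma update_agree (X Y : Type) (h : X -> Y) (s : seq nat) e e' n x :
  {in [seq m <- s | m != n], forall m, e' m = h (e m)} ->
  {in s, forall m, [eta e' with n |-> h x] m = h ([eta e with n |-> x] m)}.
Proof.
move=> eq_e m sm /=; case: eqVneq => // neq_mn.
by apply: eq_e; rewrite mem_filter neq_mn.
Qed.

(** Only the free variables matter; for f and g the identity maps this is
    the coincidence lemma. *)
Lemma sat_iso phi ec ea ec' ea' :
    {in free_cvars phi, forall n, ec' n = f (ec n)} ->
    {in free_avars phi, forall n, ea' n = g (ea n)} ->
  sat ec ea phi <-> sat ec' ea' phi.
Proof.
have [f' fK f'K] := f_bij; have [g' gK g'K] := g_bij.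
have sub2 (T : eqType) (s1 s2 : seq nat) (e' : nat -> T) e :
  {in s1 ++ s2, forall n, e' n = e n} ->
  {in s1, forall n, e' n = e n} /\ {in s2, forall n, e' n = e n}.
  by move=> eq_e; split=> n sn; apply: eq_e; rewrite mem_cat sn ?orbT.
elim: phi ec ea ec' ea' => [t1 t2|t1 t2|a t1 t2||p IHp|p IHp q IHq|p IHp q IHq
  |p IHp q IHq|n p IHp|n p IHp|n p IHp|n p IHp] ec ea ec' ea' /=.
- move=> /sub2[e1 e2] _; rewrite (ceval_iso e1) (ceval_iso e2).
  by split=> [->//|]; apply: can_inj fK _ _.
- move=> _ /sub2[e1 e2]; rewrite (aeval_iso e1) (aeval_iso e2).
  by split=> [->//|]; apply: can_inj gK _ _.
- move=> /sub2[e1 e2] ea1.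
  rewrite (ceval_iso e1) (ceval_iso e2) (aeval_iso ea1) -fZ.
  by split=> [->//|]; apply: can_inj fK _ _.
- by [].
- by move=> eqc eqa; have := IHp _ _ _ _ eqc eqa; tauto.
- move=> /sub2[c1 c2] /sub2[a1 a2].
  by have := IHp _ _ _ _ c1 a1; have := IHq _ _ _ _ c2 a2; tauto.
- move=> /sub2[c1 c2] /sub2[a1 a2].
  by have := IHp _ _ _ _ c1 a1; have := IHq _ _ _ _ c2 a2; tauto.
- move=> /sub2[c1 c2] /sub2[a1 a2].
  by have := IHp _ _ _ _ c1 a1; have := IHq _ _ _ _ c2 a2; tauto.
- move=> eqc eqa; have IH x := IHp _ _ _ _ (update_agree x eqc) eqa.
  by split=> [Hp y|Hp x]; [rewrite -[y]f'K | ]; apply/IH.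
- move=> eqc eqa; have IH x := IHp _ _ _ _ (update_agree x eqc) eqa.
  split=> [[x px]|[y py]]; first by exists (f x); apply/IH.
  by exists (f' y); apply/IH; rewrite f'K.
- move=> eqc eqa; have IH x := IHp _ _ _ _ eqc (update_agree x eqa).
  by split=> [Hp y|Hp x]; [rewrite -[y]g'K | ]; apply/IH.
- move=> eqc eqa; have IH x := IHp _ _ _ _ eqc (update_agree x eqa).
  split=> [[x px]|[y py]]; first by exists (g x); apply/IH.
  by exists (g' y); apply/IH; rewrite g'K.
Qed.
End IsomorphismInvariance.

Lemma sat_coincide (M : two_sorted_algebra) phi (ec ec' : nat -> carrier M)
    (ea ea' : nat -> scalar M) :
    {in free_cvars phi, ec' =1 ec} -> {in free_avars phi, ea' =1 ea} ->
  sat ec ea phi <-> sat ec' ea' phi.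
Proof.
apply: (@sat_iso M M idfun idfun) => //; exact: (Bijective (g := id)).
Qed.

Definition ex_closure (phi : formula) :=
  foldr ExC (foldr ExA phi (free_avars phi)) (free_cvars phi).

Lemma free_foldr_ExC s phi :
  free_cvars (foldr ExC phi s) = [seq m <- free_cvars phi | m \notin s] /\
  free_avars (foldr ExC phi s) = free_avars phi.
Proof.
elim: s => [|n s [IHc IHa]] /=; first by rewrite filter_predT.
by rewrite IHc IHa -filter_predI; split=> //; apply: eq_filter => m;
  rewrite /= inE negb_or.
Qed.

Lemma free_foldr_ExA s phi :
  free_avars (foldr ExA phi s) = [seq m <- free_avars phi | m \notin s] /\
  free_cvars (foldr ExA phi s) = free_cvars phi.
Proof.
elim: s => [|n s [IHa IHc]] /=; first by rewrite filter_predT.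
by rewrite IHc IHa -filter_predI; split=> //; apply: eq_filter => m;
  rewrite /= inE negb_or.
Qed.

Lemma ex_closure_sentence phi : is_sentence (ex_closure phi).
Proof.
have [c1 a1] := free_foldr_ExC (free_cvars phi)
  (foldr ExA phi (free_avars phi)).
have [a2 c2] := free_foldr_ExA (free_avars phi) phi.
rewrite /is_sentence /ex_closure c1 a1 a2 c2; split.
  by rewrite (@eq_in_filter _ _ pred0) ?filter_pred0 // => m ->.
by rewrite (@eq_in_filter _ _ pred0) ?filter_pred0 // => m ->.
Qed.

Section ExClosure.
Variable M : two_sorted_algebra.
Implicit Types (ec : nat -> carrier M) (ea : nat -> scalar M).

Lemma sat_foldr_ExC s p ec ea :
  sat ec ea (foldr ExC p s) -> exists ec', sat ec' ea p.
Proof.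
by elim: s ec => [|n s IHs] ec /=; [exists ec | case=> x /IHs].
Qed.

Lemma sat_foldr_ExA s p ec ea :
  sat ec ea (foldr ExA p s) -> exists ea', sat ec ea' p.
Proof.
by elim: s ea => [|n s IHs] ea /=; [exists ea | case=> x /IHs].
Qed.

Lemma foldr_ExC_sat s p ec0 ec ea :
  sat (fun n => if n \in s then ec0 n else ec n) ea p ->
  sat ec ea (foldr ExC p s).
Proof.
elim: s ec => //= n s IHs ec sat_p; exists (ec0 n); apply: IHs.
rewrite (_ : (fun _ => _) = fun m => if m \in n :: s then ec0 m else ec m) //.
apply/funext => m /=; rewrite inE.
by case: eqVneq => [->|_] //=; case: ifP.
Qed.

Lemma foldr_ExA_sat s p ec ea0 ea :
  sat ec (fun n => if n \in s then ea0 n else ea n) p ->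
  sat ec ea (foldr ExA p s).
Proof.
elim: s ea => //= n s IHs ea sat_p; exists (ea0 n); apply: IHs.
rewrite (_ : (fun _ => _) = fun m => if m \in n :: s then ea0 m else ea m) //.
apply/funext => m /=; rewrite inE.
by case: eqVneq => [->|_] //=; case: ifP.
Qed.

Lemma models_ex_closure phi :
  models M (ex_closure phi) <-> exists ec ea, @sat M ec ea phi.
Proof.
split=> [/(_ (fun=> 0) (fun=> 0)) /sat_foldr_ExC[ec /sat_foldr_ExA[ea]]|].
  by exists ec, ea.
move=> [ec0 [ea0 sat_phi]] ec ea.
apply: (@foldr_ExC_sat _ _ ec0); apply: (@foldr_ExA_sat _ _ _ ea0).
by apply: (proj1 (sat_coincide _ _) sat_phi) => n /= ->.
Qed.
End ExClosure.

(** Definability by one formula, uniformly in all two-sorted algebras. *)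
Definition expressible
    (P : forall N : two_sorted_algebra,
         (nat -> carrier N) -> (nat -> scalar N) -> Prop) :=
  exists phi, forall (N : two_sorted_algebra) ec ea, @sat N ec ea phi <-> P N ec ea.

Lemma expressible_and P Q : expressible P -> expressible Q ->
  expressible (fun N ec ea => P N ec ea /\ Q N ec ea).
Proof.
move=> [p pP] [q qQ]; exists (And p q) => N ec ea /=.
by have := pP N ec ea; have := qQ N ec ea; tauto.
Qed.

Lemma expressible_iff P Q : (forall N ec ea, P N ec ea <-> Q N ec ea) ->
  expressible P -> expressible Q.
Proof.
move=> PQ [p pP]; exists p => N ec ea.
by have := pP N ec ea; have := PQ N ec ea; tauto.
Qed.

Section FiniteConnectives.
Variables (T : eqType) (F : T -> formula).

Definition all_of (s : seq T) := foldr (fun v p => And (F v) p) (Not Bot) s.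
Definition some_of (s : seq T) := foldr (fun v p => Or (F v) p) Bot s.

Lemma sat_all_of (N : two_sorted_algebra) s (ec : nat -> carrier N) ea :
  sat ec ea (all_of s) <-> forall v, v \in s -> sat ec ea (F v).
Proof.
elim: s => [|v s IHs] /=; first by split=> // _ [].
split=> [[Fv /IHs Fs] u|Fs]; first by rewrite inE => /predU1P[->|/Fs].
split; first by apply: Fs; rewrite mem_head.
by apply/IHs => u su; apply: Fs; rewrite inE su orbT.
Qed.

Lemma sat_some_of (N : two_sorted_algebra) s (ec : nat -> carrier N) ea :
  sat ec ea (some_of s) <-> exists2 v, v \in s & sat ec ea (F v).
Proof.
elim: s => [|v s IHs] /=; first by split=> // -[].
split=> [[Fv|/IHs[u su Fu]]|[u]].
- by exists v; rewrite ?mem_head.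
- by exists u; rewrite // inE su orbT.
- by rewrite inE => /predU1P[->|su Fu]; [left | right; apply/IHs; exists u].
Qed.

End FiniteConnectives.

Definition anat k t := iter k (AAdd t) AZero.
Definition cnat k t := iter k (CAdd t) CZero.
Definition apow k t := iter k (AMul t) AOne.

Definition int_pos (z : int) := if z is Posz n then n else 0%N.
Definition int_neg (z : int) := if z is Negz n then n.+1 else 0%N.

Lemma mulrz_posneg (V : zmodType) (x : V) z :
  x *~ z = x *+ int_pos z - x *+ int_neg z.
Proof.
case: z => n /=; first by rewrite subr0 -pmulrn.
by rewrite NegzE mulrNz sub0r.
Qed.

(** Variables 0 to 3 of each sort are bound by the inner quantifiers; the
    named generators are the variables from 4 on. *)
Definition named (T : Type) (e : nat -> T) i := e i.+4.

Definition alin n (c : 'I_n -> nat) :=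
  foldr (fun i t => AAdd (anat (c i) (AVar (val i).+4)) t) AZero (enum 'I_n).
Definition clin n (c : 'I_n -> nat) :=
  foldr (fun i t => CAdd (cnat (c i) (CVar (val i).+4)) t) CZero (enum 'I_n).

(** The language has no subtraction: a combination with integer coefficients
    is split into its positive and negative parts. *)
Definition eq_alin n (t : aterm) (c : 'rV[int]_n) :=
  EqA (AAdd t (alin (fun i => int_neg (c 0 i))))
      (alin (fun i => int_pos (c 0 i))).
Definition eq_clin n (t : cterm) (c : 'rV[int]_n) :=
  EqC (CAdd t (clin (fun i => int_neg (c 0 i))))
      (clin (fun i => int_pos (c 0 i))).

Section Terms.
Variables (N : two_sorted_algebra).
Implicit Types (ec : nat -> carrier N) (ea : nat -> scalar N).

Lemma aeval_anat ea k t : aeval ea (anat k t) = aeval ea t *+ k.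
Proof. by elim: k => //= k ->; rewrite mulrS. Qed.

Lemma ceval_cnat ec k t : ceval ec (cnat k t) = ceval ec t *+ k.
Proof. by elim: k => //= k ->; rewrite mulrS. Qed.

Lemma aeval_apow ea k t : aeval ea (apow k t) = aeval ea t ^+ k.
Proof. by elim: k => //= k ->; rewrite exprS. Qed.

Lemma aeval_alin ea n (c : 'I_n -> nat) :
  aeval ea (alin c) = \sum_(i < n) named ea i *+ c i.
Proof.
rewrite -big_enum /alin; elim: (enum _) => [|i s IHs] /=; first by rewrite big_nil.
by rewrite big_cons IHs aeval_anat.
Qed.

Lemma ceval_clin ec n (c : 'I_n -> nat) :
  ceval ec (clin c) = \sum_(i < n) named ec i *+ c i.
Proof.
rewrite -big_enum /clin; elim: (enum _) => [|i s IHs] /=; first by rewrite big_nil.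
by rewrite big_cons IHs ceval_cnat.
Qed.

Lemma lin_posneg (V : zmodType) n (b : nat -> V) (c : 'rV[int]_n) x :
  (x + \sum_(i < n) b i *+ int_neg (c 0 i) =
     \sum_(i < n) b i *+ int_pos (c 0 i)) <-> x = lin b c.
Proof.
have -> : lin b c = \sum_(i < n) b i *+ int_pos (c 0 i) -
                    \sum_(i < n) b i *+ int_neg (c 0 i).
  by rewrite -sumrB; apply: eq_bigr => i _; rewrite mulrz_posneg.
by split=> [<-|->]; rewrite ?addrK ?subrK.
Qed.

Lemma sat_eq_alin ec ea n t (c : 'rV[int]_n) :
  sat ec ea (eq_alin t c) <-> aeval ea t = lin (named ea) c.
Proof. by rewrite /= !aeval_alin; apply: lin_posneg. Qed.

Lemma sat_eq_clin ec ea n t (c : 'rV[int]_n) :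
  sat ec ea (eq_clin t c) <-> ceval ec t = lin (named ec) c.
Proof. by rewrite /= !ceval_clin; apply: lin_posneg. Qed.

End Terms.

(** * The conditions are first-order *)

Section ExpressRingTest.
Variables (A : comPzRingType) (n : nat) (co : A -> 'rV[int]_n) (d : ring_data A).
Local Notation m := (rd_m d).
Local Notation k := (rd_k d).
Local Notation D := (rd_D d).
Local Notation X0 := (AVar 0).
Local Notation X1 := (AVar 1).
Local Notation X2 := (AVar 2).
Local Notation X3 := (AVar 3).

(** The candidate image of a : A when the named elements of N stand for the
    generators of A. *)
Definition ring_map (N : two_sorted_algebra) (ea : nat -> scalar N) (a : A) :=
  lin (named ea) (co a).

Fixpoint ideal_formula (s : seq A) : formula :=
  if s is v :: s' then
    ExA 1 (ExA 2 (ExA 3 (And (eq_alin X2 (co v))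
      (And (EqA X0 (AAdd X3 (AMul X1 X2)))
           (ExA 0 (And (EqA X0 X3) (ideal_formula s')))))))
  else EqA X0 AZero.

Lemma sat_ideal_formula s (N : two_sorted_algebra) (ec : nat -> carrier N) ea :
  sat ec ea (ideal_formula s) <-> scale_span *%R (map (ring_map ea) s) (ea 0%N).
Proof.
elim: s ea => // v s IHs ea; split.
  move=> [y [u [w [/(sat_eq_alin ec) def_u [def_x [z [def_z /IHs sz]]]]]]].
  have {}def_x : ea 0%N = w + y * ring_map ea v by rewrite -[ring_map _ _]def_u.
  by exists y; rewrite def_x addrK -[w]def_z; exact: sz.
move=> [y sy]; exists y, (ring_map ea v), (ea 0%N - y * ring_map ea v).
split; first exact/sat_eq_alin.
split; first by rewrite /= subrK.
exists (ea 0%N - y * ring_map ea v); split=> //.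
by apply/IHs; exact: sy.
Qed.

Lemma express_ring_test :
  expressible (fun N ec ea => ring_test d (@ring_map N ea)).
Proof.
have eTwo : expressible (fun N ec ea =>
    forall x : scalar N, x *+ m *+ 2 = 0 -> x *+ m = 0).
  exists (AllA 0 (Imp (EqA (anat 2 (anat m X0)) AZero) (EqA (anat m X0) AZero))).
  by move=> N ec ea; split=> H x; have := H x; rewrite /= !aeval_anat addr0.
have eOdd : expressible (fun N ec ea => forall x y : scalar N,
    x *+ m + y * (x *+ m) *+ 2 = 0 -> x *+ m = 0).
  exists (AllA 0 (AllA 1 (Imp
    (EqA (AAdd (anat m X0) (anat 2 (AMul X1 (anat m X0)))) AZero)
    (EqA (anat m X0) AZero)))).
  by move=> N ec ea; split=> H x y; have := H x y; rewrite /= !aeval_anat addr0.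
have eExponent : expressible (fun N ec ea => forall x : scalar N,
    x ^+ (k + k) *+ m = 0 -> x ^+ k *+ m = 0).
  exists (AllA 0 (Imp (EqA (anat m (apow (k + k) X0)) AZero)
                      (EqA (anat m (apow k X0)) AZero))).
  move=> N ec ea.
  by split=> H x; have := H x; rewrite /= !aeval_anat !aeval_apow.
have eTorsion : expressible (fun N ec ea => forall x : scalar N,
    x *+ m = 0 -> exists2 v, v \in rd_torsion d & x = ring_map ea v).
  exists (AllA 0 (Imp (EqA (anat m X0) AZero)
    (some_of (fun v => eq_alin X0 (co v)) (rd_torsion d)))).
  move=> N ec ea; split=> H x.
    move=> xm; have [|v Tv /sat_eq_alin def_x] := (sat_some_of _ _ _ _).1 (H x _).
      by rewrite /= aeval_anat.
    by exists v.
  rewrite /= aeval_anat => /(H x)[v Tv def_x]; apply/sat_some_of.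
  by exists v => //; apply/sat_eq_alin.
have eNil : expressible (fun N ec ea => forall x : scalar N,
    x ^+ k *+ m = 0 -> scale_span *%R (map (ring_map ea) (rd_nil d)) x).
  exists (AllA 0 (Imp (EqA (anat m (apow k X0)) AZero)
                      (ideal_formula (rd_nil d)))).
  move=> N ec ea; split=> H x xk.
    apply: (sat_ideal_formula _ _ _).1 (H x _).
    by rewrite /= aeval_anat aeval_apow.
  apply/sat_ideal_formula; apply: H; move: xk.
  by rewrite /= aeval_anat aeval_apow.
have eResidues : expressible (fun N ec ea => forall x : scalar N,
    exists2 v, v \in rd_residues d & exists y w,
    x = ring_map ea v + y *+ D + w /\ w ^+ k *+ m = 0).
  exists (AllA 0 (some_of (fun v => ExA 1 (ExA 2 (ExA 3 (And (eq_alin X3 (co v))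
    (And (EqA X0 (AAdd (AAdd X3 (anat D X1)) X2))
         (EqA (anat m (apow k X2)) AZero)))))) (rd_residues d))).
  move=> N ec ea; split=> H x.
    have [v Rv [y [w [u [/(sat_eq_alin ec) def_u [def_x wk]]]]]] :=
      (sat_some_of _ _ _ _).1 (H x).
    exists v => //; exists y, w; rewrite -[ring_map _ _]def_u.
    by move: def_x wk; rewrite /= !aeval_anat aeval_apow.
  have [v Rv [y [w [def_x wk]]]] := H x; apply/sat_some_of.
  exists v => //; exists y, w, (ring_map ea v).
  by split; [apply/sat_eq_alin | rewrite /= !aeval_anat aeval_apow].
have eNonzero : expressible (fun N ec ea => forall v, v \in rd_nonzero d ->
    forall y : scalar N, y *+ D <> ring_map ea v).
  exists (all_of (fun v => AllA 1 (Not (eq_alin (anat D X1) (co v))))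
                 (rd_nonzero d)).
  move=> N ec ea; split=> [/sat_all_of H v Sv y yv|H].
    by apply: (H v Sv y); apply/(sat_eq_alin ec); rewrite aeval_anat.
  apply/sat_all_of => v Sv y /(sat_eq_alin ec); rewrite aeval_anat.
  exact: H v Sv y.
have := expressible_and eTwo (expressible_and eOdd (expressible_and eExponent
  (expressible_and eTorsion (expressible_and eNil
  (expressible_and eResidues eNonzero))))).
apply: expressible_iff => N ec ea; split.
  by move=> [? [? [? [? [? [? ?]]]]]].
by case=> *; do !split.
Qed.

End ExpressRingTest.

Section ExpressModuleTest.
Variables (A : comPzRingType) (C : lmodType A).
Variables (n : nat) (co : C -> 'rV[int]_n) (d : module_data C).
Local Notation m := (md_m d).
Local Notation X0 := (CVar 0).
Local Notation X1 := (CVar 1).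
Local Notation X2 := (CVar 2).
Local Notation X3 := (CVar 3).

Definition module_map (N : two_sorted_algebra) (ec : nat -> carrier N) (c : C) :=
  lin (named ec) (co c).

Fixpoint submodule_formula (s : seq C) : formula :=
  if s is v :: s' then
    ExA 0 (ExC 1 (ExC 2 (ExC 3 (And (eq_clin X1 (co v))
      (And (Scal (AVar 0) X1 X2) (And (EqC X0 (CAdd X3 X2))
           (ExC 0 (And (EqC X0 X3) (submodule_formula s')))))))))
  else EqC X0 CZero.

Lemma sat_submodule_formula s (N : two_sorted_algebra) (ec : nat -> carrier N) ea :
  sat ec ea (submodule_formula s) <->
  scale_span *:%R (map (module_map ec) s) (ec 0%N).
Proof.
elim: s ec ea => // v s IHs ec ea; split.
  move=> [y [u [t [w [/(sat_eq_clin _ ea) def_u [def_t [def_x [z [def_z sz]]]]]]]]].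
  move/IHs in sz.
  have {}def_x : ec 0%N = w + y *: module_map ec v.
    by rewrite -[module_map _ _]def_u -[RHS]/(w + y *: u) [y *: u]def_t.
  by exists y; rewrite def_x addrK -[w]def_z; exact: sz.
move=> [y sy]; exists y, (module_map ec v), (y *: module_map ec v).
exists (ec 0%N - y *: module_map ec v).
split; first exact/sat_eq_clin.
split=> //; split; first by rewrite /= subrK.
exists (ec 0%N - y *: module_map ec v); split=> //.
by apply/IHs; exact: sy.
Qed.

Lemma express_module_test :
  expressible (fun N ec ea => module_test d (@module_map N ec)).
Proof.
have eTwo : expressible (fun N ec ea =>
    forall x : carrier N, x *+ m *+ 2 = 0 -> x *+ m = 0).
  exists (AllC 0 (Imp (EqC (cnat 2 (cnat m X0)) CZero) (EqC (cnat m X0) CZero))).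
  by move=> N ec ea; split=> H x; have := H x; rewrite /= !ceval_cnat addr0.
have eOdd : expressible (fun N ec ea => forall (x : carrier N) (y : scalar N),
    x *+ m + y *: (x *+ m) *+ 2 = 0 -> x *+ m = 0).
  exists (AllC 0 (AllA 0 (AllC 1 (Imp (Scal (AVar 0) (cnat m X0) X1)
    (Imp (EqC (CAdd (cnat m X0) (cnat 2 X1)) CZero)
         (EqC (cnat m X0) CZero)))))).
  move=> N ec ea; split=> H x y.
    by have := H x y (y *: (x *+ m)); rewrite /= !ceval_cnat addr0; apply.
  by move=> z; have := H x y; rewrite /= !ceval_cnat /= addr0 => Hxy <-.
have eGens : expressible (fun N ec ea => forall x : carrier N,
    scale_span *:%R (map (module_map ec) (md_gens d)) x).
  exists (AllC 0 (submodule_formula (md_gens d))).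
  move=> N ec ea; split=> H x; first exact: (sat_submodule_formula _ _ _).1 (H x).
  by apply/sat_submodule_formula; apply: H.
have eNonzero : expressible (fun N ec ea => forall v, v \in md_nonzero d ->
    forall y : carrier N, y *+ (m * 2) <> module_map ec v).
  exists (all_of (fun v => AllC 1 (Not (eq_clin (cnat (m * 2) X1) (co v))))
                 (md_nonzero d)).
  move=> N ec ea; split=> [/sat_all_of H v Sv y yv|H].
    by apply: (H v Sv y); apply/(sat_eq_clin _ ea); rewrite ceval_cnat.
  apply/sat_all_of => v Sv y /(sat_eq_clin _ ea); rewrite ceval_cnat.
  exact: H v Sv y.
have := expressible_and eTwo (expressible_and eOdd (expressible_and eGens eNonzero)).
apply: expressible_iff => N ec ea; split.
  by move=> [? [? [? ?]]].
by case=> *; do !split.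
Qed.

End ExpressModuleTest.

(** * The sentence *)

Lemma additive_of (V W : zmodType) (f : V -> W) : {morph f : x y / x - y} ->
  exists F : {additive V -> W}, F = f :> (V -> W).
Proof.
move=> fB; pose F : {additive V -> W} :=
  HB.pack f (GRing.isZmodMorphism.Build V W f fB).
by exists F.
Qed.

Lemma rmorphism_of (A B : comPzRingType) (f : A -> B) :
    {morph f : x y / x - y} -> f 1 = 1 -> {morph f : x y / x * y} ->
  exists F : {rmorphism A -> B}, F = f :> (A -> B).
Proof.
move=> fB f1 fM; pose F : {rmorphism A -> B} :=
  HB.pack f (GRing.isZmodMorphism.Build A B f fB)
    (GRing.isMonoidMorphism.Build A B f (f1, fM)).
by exists F.
Qed.

Lemma inj_surj_bij (X Y : Type) (f : X -> Y) :
  injective f -> (forall y, exists x, y = f x) -> bijective f.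
Proof.
move=> f_inj /choice[f' f'K]; exists f' => [x|y]; last by rewrite -f'K.
by apply: f_inj; rewrite -f'K.
Qed.

Lemma fin_gen_carrier (M : two_sorted_algebra) : in_classA M ->
  exists g : seq (carrier M), forall x, span g x.
Proof.
move=> [[n [u gen_u]] /fin_gen_span[gA genA]].
pose g := [seq a *: u i | a <- gA, i <- enum 'I_n].
have sg := span_subgroup g.
exists g => x; have [c ->] := gen_u x; apply: subgroup_sum => // i _.
have sP : subgroup (fun a => span g (a *: u i)).
  split; first by rewrite scale0r; apply: subgroup0 sg.
  by move=> a b ga gb; rewrite scalerBl; apply: subgroupB.
apply: (span_min sP _ (genA (c i))) => a Aa.
by apply/mem_span/allpairsP; exists (a, i); rewrite mem_enum.
Qed.

Lemma coordinates (V : zmodType) (g : seq V) : (forall x, span g x) ->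
  exists co : V -> 'rV[int]_(size g), forall x, x = lin (nth 0 g) (co x).
Proof.
by move=> genV; have [co coK] := choice (fun x => span_coord (genV x)); exists co.
Qed.

(** Compatibility with each of the three products is an equality of two
    biadditive maps, to be checked on generators. *)
Definition biadditive (V1 V2 W : zmodType) (F : V1 -> V2 -> W) :=
  (forall y, {morph F^~ y : x x' / x - x'}) /\
  (forall x, {morph F x : y y' / y - y'}).

Lemma biadditive_eq (V1 V2 W : zmodType) (g1 : seq V1) (g2 : seq V2)
    (F G : V1 -> V2 -> W) :
    (forall x, span g1 x) -> (forall y, span g2 y) ->
    biadditive F -> biadditive G ->
    (forall x y, x \in g1 -> y \in g2 -> F x y = G x y) ->
  forall x y, F x y = G x y.
Proof.
move=> gen1 gen2 [Fl Fr] [Gl Gr] FG x y.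
have sub_eq (U : zmodType) (f f' : U -> W) :
    {morph f : u v / u - v} -> {morph f' : u v / u - v} ->
  subgroup (fun u => f u = f' u).
  move=> fB f'B; split=> [|u v eu ev]; last by rewrite fB f'B eu ev.
  by rewrite -(subrr 0) fB f'B !subrr.
apply: (span_min (sub_eq _ _ _ (Fl y) (Gl y)) _ (gen1 x)) => {}x g1x.
apply: (span_min (sub_eq _ _ _ (Fr x) (Gr x)) _ (gen2 y)) => {}y g2y.
exact: FG.
Qed.

Lemma amul_biadditive (M : two_sorted_algebra) : biadditive (@amul M).
Proof.
split=> z x y; have subE (u v : carrier M) : u - v = (-1) *: v + u.
- by rewrite scaleN1r addrC.
- by rewrite subE /= (amul_linearl z (-1) y x) -subE.
- by rewrite scaleN1r addrC.
- by rewrite subE (amul_linearr z (-1) y x) -subE.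
Qed.

Section Presentations.
Variable M : two_sorted_algebra.
Variables (gA : seq (scalar M)) (gC : seq (carrier M)).
Local Notation n := (size gA).
Local Notation t := (size gC).
Local Notation a := (nth 0 gA).
Local Notation c := (nth 0 gC).
Variables (coA : scalar M -> 'rV[int]_n) (coC : carrier M -> 'rV[int]_t).
Variables (RA : seq 'rV[int]_n) (RC : seq 'rV[int]_t).

(** The named elements of N satisfy a presentation of M as a two-sorted algebra:
    the additive relations and the multiplication tables. *)
Record presented (N : two_sorted_algebra) (ec : nat -> carrier N)
    (ea : nat -> scalar N) : Prop := Presented {
  pr_relA : forall r, r \in RA -> lin (named ea) r = 0;
  pr_relC : forall r, r \in RC -> lin (named ec) r = 0;
  pr_one : 1 = lin (named ea) (coA 1);
  pr_mul : forall i j : 'I_n,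
    named ea i * named ea j = lin (named ea) (coA (a i * a j));
  pr_amul : forall i j : 'I_t,
    amul (named ec i) (named ec j) = lin (named ec) (coC (amul (c i) (c j)));
  pr_scale : forall (i : 'I_n) (j : 'I_t),
    named ea i *: named ec j = lin (named ec) (coC (a i *: c j))
}.

Lemma express_presented : expressible presented.
Proof.
have eRelA : expressible (fun N ec ea =>
    forall r, r \in RA -> lin (named ea) r = 0 :> scalar N).
  exists (all_of (eq_alin AZero) RA) => N ec ea.
  split=> [/sat_all_of H r /H/(sat_eq_alin ec) //|H].
  by apply/sat_all_of => r /H rb; apply/sat_eq_alin.
have eRelC : expressible (fun N ec ea =>
    forall r, r \in RC -> lin (named ec) r = 0 :> carrier N).
  exists (all_of (eq_clin CZero) RC) => N ec ea.
  split=> [/sat_all_of H r /H/(sat_eq_clin _ ea) //|H].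
  by apply/sat_all_of => r /H rb; apply/sat_eq_clin.
have eOne : expressible (fun N ec ea => 1 = lin (named ea) (coA 1) :> scalar N).
  by exists (eq_alin AOne (coA 1)) => N ec ea; apply: sat_eq_alin.
have eMul : expressible (fun N ec ea => forall i j : 'I_n,
    named ea i * named ea j = lin (named ea) (coA (a i * a j)) :> scalar N).
  exists (all_of (fun ij : 'I_n * 'I_n => eq_alin
    (AMul (AVar (val ij.1).+4) (AVar (val ij.2).+4)) (coA (a ij.1 * a ij.2)))
    (enum {: 'I_n * 'I_n})) => N ec ea.
  split=> [/sat_all_of H i j|H]; last first.
    by apply/sat_all_of => -[i j] _; apply/sat_eq_alin; apply: H.
  exact: (proj1 (sat_eq_alin ec _ _ _) (H (i, j) (mem_enum _ _))).
have eAmul : expressible (fun N ec ea => forall i j : 'I_t,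
    amul (named ec i) (named ec j) = lin (named ec) (coC (amul (c i) (c j)))
    :> carrier N).
  exists (all_of (fun ij : 'I_t * 'I_t => eq_clin
    (CMul (CVar (val ij.1).+4) (CVar (val ij.2).+4)) (coC (amul (c ij.1) (c ij.2))))
    (enum {: 'I_t * 'I_t})) => N ec ea.
  split=> [/sat_all_of H i j|H]; last first.
    by apply/sat_all_of => -[i j] _; apply/sat_eq_clin; apply: H.
  exact: (proj1 (sat_eq_clin _ ea _ _) (H (i, j) (mem_enum _ _))).
have eScale : expressible (fun N ec ea => forall (i : 'I_n) (j : 'I_t),
    named ea i *: named ec j = lin (named ec) (coC (a i *: c j)) :> carrier N).
  exists (all_of (fun ij : 'I_n * 'I_t => ExC 0
    (And (Scal (AVar (val ij.1).+4) (CVar (val ij.2).+4) (CVar 0))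
         (eq_clin (CVar 0) (coC (a ij.1 *: c ij.2)))))
    (enum {: 'I_n * 'I_t})) => N ec ea.
  split=> [/sat_all_of H i j|H]; last first.
    apply/sat_all_of => -[i j] _; exists (named ea i *: named ec j).
    by split=> //; apply/sat_eq_clin; apply: H.
  have [x [def_x xE]] := H (i, j) (mem_enum _ _).
  exact: etrans def_x (proj1 (sat_eq_clin _ ea _ _) xE).
have := expressible_and eRelA (expressible_and eRelC (expressible_and eOne
  (expressible_and eMul (expressible_and eAmul eScale)))).
apply: expressible_iff => N ec ea; split.
  by move=> [? [? [? [? [? ?]]]]].
by case=> *; do !split.
Qed.

Hypotheses (coAK : forall x, x = lin a (coA x)) (coCK : forall x, x = lin c (coC x)).
Hypotheses (genRA : forall z, lin a z = 0 -> span RA z).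
Hypotheses (genRC : forall z, lin c z = 0 -> span RC z).

Lemma presented_morphism (N : two_sorted_algebra) (ec : nat -> carrier N) ea :
    (forall x, span gA x) -> (forall x, span gC x) -> presented ec ea ->
  exists (h : {rmorphism scalar M -> scalar N})
         (f : {additive carrier M -> carrier N}),
    [/\ h = ring_map coA ea :> (_ -> _), f = module_map coC ec :> (_ -> _),
        forall x y, f (amul x y) = amul (f x) (f y)
      & forall r x, f (r *: x) = h r *: f x].
Proof.
move=> genA genC pr.
have [hB h_gen] := lin_extends coAK genRA (pr_relA pr).
have [fB f_gen] := lin_extends coCK genRC (pr_relC pr).
have memA x : x \in gA -> exists i : 'I_n, x = a i.
  move=> gx; have ix : (index x gA < n)%N by rewrite index_mem.
  by exists (Ordinal ix); rewrite /= nth_index.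
have memC x : x \in gC -> exists i : 'I_t, x = c i.
  move=> gx; have ix : (index x gC < t)%N by rewrite index_mem.
  by exists (Ordinal ix); rewrite /= nth_index.
have [f def_f] := additive_of fB; have [h0 def_h0] := additive_of hB.
have [h def_h] : exists h : {rmorphism scalar M -> scalar N}, h = h0 :> (_ -> _).
  apply: rmorphism_of; first exact: raddfB.
    by rewrite def_h0 -(pr_one pr).
  apply: (biadditive_eq genA genA).
  - split=> [y x x'|x y y']; first by rewrite mulrBl raddfB.
    by rewrite mulrBr raddfB.
  - split=> [y x x'|x y y']; first by rewrite raddfB mulrBl.
    by rewrite raddfB mulrBr.
  by move=> _ _ /memA[i ->] /memA[j ->]; rewrite def_h0 -(pr_mul pr) !h_gen.
exists h, f; split=> //; first by rewrite def_h.
- have [amulBl amulBr] := amul_biadditive M.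
  have [amulBl' amulBr'] := amul_biadditive N.
  apply: (biadditive_eq genC genC).
  - split=> [y x x'|x y y']; first by rewrite amulBl raddfB.
    by rewrite amulBr raddfB.
  - split=> [y x x'|x y y']; first by rewrite raddfB amulBl'.
    by rewrite raddfB amulBr'.
  by move=> _ _ /memC[i ->] /memC[j ->]; rewrite def_f -(pr_amul pr) !f_gen.
apply: (biadditive_eq genA genC).
- split=> [y x x'|x y y']; first by rewrite scalerBl raddfB.
  by rewrite scalerBr raddfB.
- split=> [y x x'|x y y']; first by rewrite raddfB scalerBl.
  by rewrite raddfB scalerBr.
move=> _ _ /memA[i ->] /memC[j ->].
by rewrite def_h def_h0 def_f -(pr_scale pr) h_gen !f_gen.
Qed.
End Presentations.

Lemma isomorphic_models (M N : two_sorted_algebra) phi :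
  is_sentence phi -> isomorphic M N -> models M phi -> models N phi.
Proof.
move=> [noC noA] [f [g [f_bij g_bij fM fZ]]] M_phi ec ea.
apply: (proj1 (sat_iso f_bij g_bij fM fZ (ec := fun=> 0) (ea := fun=> 0) _ _)).
- by rewrite noC.
- by rewrite noA.
exact: M_phi.
Qed.

(** The sentence says that some elements satisfy the presentation of M and that
    the induced maps pass the two tests. *)
Theorem theorem1p4 (M : two_sorted_algebra) (hM : in_classA M) :
  exists phi : formula,
    [/\ is_sentence phi, models M phi
      & forall N : two_sorted_algebra, in_classA N ->
          (models N phi <-> isomorphic M N)].
Proof.
have [gA genA] := fin_gen_span hM.2.
have [gC genC] := fin_gen_carrier hM.
have [coA coAK] := coordinates genA.
have [coC coCK] := coordinates genC.
have [RA [RA0 genRA]] := relations_fin_gen (size gA) (nth 0 gA).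
have [RC [RC0 genRC]] := relations_fin_gen (size gC) (nth 0 gC).
have [dA dA_ok dA_test] := ring_data_exists genA.
have [dC dC_ok dC_test] := module_data_exists genC.
have [psi psiP] := expressible_and (express_presented coA coC RA RC)
  (expressible_and (express_ring_test coA dA) (express_module_test coC dC)).
have M_psi : models M (ex_closure psi).
  apply/models_ex_closure.
  pose ec i := nth 0 gC (i - 4)%N; pose ea i := nth 0 gA (i - 4)%N.
  have namedA : named ea = nth 0 gA.
    by apply/funext => i; rewrite /named /ea -[i.+4]addn4 addnK.
  have namedC : named ec = nth 0 gC.
    by apply/funext => i; rewrite /named /ec -[i.+4]addn4 addnK.
  exists ec, ea; apply/psiP; split.
    split=> [r Rr|r Rr||i j|i j|i j]; rewrite ?namedA ?namedC.
    - exact: RA0.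
    - exact: RC0.
    - exact: coAK.
    - exact: coAK.
    - exact: coCK.
    - exact: coCK.
  split.
    rewrite (_ : ring_map coA ea = id) //.
    by apply/funext => x; rewrite /ring_map namedA -coAK.
  rewrite (_ : module_map coC ec = id) //.
  by apply/funext => x; rewrite /module_map namedC -coCK.
exists (ex_closure psi); split=> //; first exact: ex_closure_sentence.
move=> N hN; split; last first.
  by move/isomorphic_models; apply=> //; apply: ex_closure_sentence.
move/models_ex_closure => [ec [ea /psiP[pr [rtest mtest]]]].
have [h [f [def_h def_f fM fZ]]] :=
  presented_morphism coAK coCK genRA genRC genA genC pr.
rewrite -def_h in rtest; rewrite -def_f in mtest.
have [gB genB] := fin_gen_span hN.2.
have h_surj := ring_test_surj genA dA_ok rtest genB.
exists f, h; split=> //.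
  apply: inj_surj_bij; first exact: module_test_inj genC dC_ok mtest.
  exact: module_test_surj mtest fZ h_surj.
exact: inj_surj_bij (ring_test_inj genA dA_ok rtest) h_surj.
Qed.
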